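(* Let $G$ be a controllable graph of order $n$ such that $\theta(G)$ is odd. If for each multiple prime factor $p$ of $\theta(G)$ (i.e. each prime $p$ with $p^2\mid\theta(G)$) the polynomial $\Phi_p(G;x)$ is squarefree, i.e. $$\gcd\{\Phi_p(G;x),\Phi_p'(G;x)\}=1\quad\text{over }\mathbb{F}_p,$$ then $G$ is determined by its generalized spectrum (DGS).
   Context: $G$ is a finite simple graph on $n$ vertices with adjacency matrix $A$ (a symmetric $(0,1)$-matrix); $e$ is the all-one vector and $J$ the $n\times n$ all-one matrix. The walk matrix is $W=W(G)=[e,Ae,\ldots,A^{n-1}e]$; $G$ is controllable if $\det W\neq 0$. The discriminant is $\Delta(G)=\prod_{i>j}(\alpha_i-\alpha_j)^2$, where $\alpha_1,\ldots,\alpha_n$ are the eigenvalues of $A$ (an integer). It is known that $2^{-\lfloor n/2\rfloor}\det W(G)$ is an integer, and $\theta(G)=\gcd\{2^{-\lfloor n/2\rfloor}\det W(G),\Delta(G)\}$. The generalized spectrum of $G$ is the ordered pair $(\sigma(G),\sigma(\bar G))$, where $\sigma$ denotes the multiset of adjacency eigenvalues and $\bar G$ is the complement of $G$. $G$ is DGS if every graph with the same generalized spectrum as $G$ is isomorphic to $G$. For a square matrix $M$, $\chi(M;x)=\det(xI-M)$. For an odd prime $p$, $\Phi_p(G;x)=\gcd\{\chi(A;x),\chi(A+J;x)\}\in\mathbb{F}_p[x]$, the gcd being taken over $\mathbb{F}_p$, and $\Phi_p'(G;x)$ denotes its formal derivative. *)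

(* Defs.v *)
From HB Require Import structures.
From mathcomp Require Import all_boot all_order all_algebra all_field.
Set Implicit Arguments.
Unset Strict Implicit.
Unset Printing Implicit Defensive.
Import Order.TTheory GRing.Theory Num.Theory.
Local Open Scope ring_scope.

Record sgraph (n : nat) := SGraph {
  adj :> rel 'I_n;
  adj_sym : symmetric adj;
  adj_irrefl : irreflexive adj
}.

Section Complement.
Variables (n : nat) (G : sgraph n).

Definition compl_adj : rel 'I_n := [rel i j | (i != j) && ~~ G i j].

Lemma compl_adj_sym : symmetric compl_adj.
Proof. by move=> i j; rewrite /compl_adj /= eq_sym adj_sym. Qed.

Lemma compl_adj_irrefl : irreflexive compl_adj.
Proof. by move=> i; rewrite /compl_adj /= eqxx. Qed.

Definition compl_graph : sgraph n := SGraph compl_adj_sym compl_adj_irrefl.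

End Complement.

Definition isomorphic (n m : nat) (G : sgraph n) (H : sgraph m) : Prop :=
  exists2 f : 'I_n -> 'I_m, bijective f & forall i j, H (f i) (f j) = G i j.

(* The coefficient ring is a parameter: the matrix is used over int, over
   algC (eigenvalues) and over 'F_p. *)
Definition adj_mx (R : nzRingType) (n : nat) (G : sgraph n) : 'M[R]_n :=
  \matrix_(i, j) (G i j)%:R.

Definition walk_mx (n : nat) (G : sgraph n) : 'M[int]_n :=
  \matrix_(i, j) (adj_mx int G ^+ j *m (const_mx 1 : 'cV_n)) i 0.

Definition controllable (n : nat) (G : sgraph n) : Prop :=
  \det (walk_mx G) != 0.

(* The eigenvalues with multiplicity, as the roots of the (monic)
   characteristic polynomial.  The order of the list is unspecified: it
   represents a multiset, to be compared with perm_eq. *)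
Definition spectrum (n : nat) (G : sgraph n) : seq algC :=
  sval (closed_field_poly_normal (char_poly (adj_mx algC G))).

(* The product is a rational integer, so that Num.floor only retracts algC
   onto int. *)
Definition discriminant (n : nat) (G : sgraph n) : int :=
  let a := spectrum G in
  Num.floor (\prod_(i < n) \prod_(j < n | (j < i)%N) (a`_i - a`_j) ^+ 2).

(* The division is exact: 2 ^ floor(n / 2) always divides det W. *)
Definition theta (n : nat) (G : sgraph n) : int :=
  gcdz (\det (walk_mx G) %/ 2 ^+ n./2)%Z (discriminant G).

Definition same_gen_spectrum (n m : nat) (G : sgraph n) (H : sgraph m) : Prop :=
  perm_eq (spectrum G) (spectrum H) /\
  perm_eq (spectrum (compl_graph G)) (spectrum (compl_graph H)).

Definition DGS (n : nat) (G : sgraph n) : Prop :=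
  forall (m : nat) (H : sgraph m), same_gen_spectrum H G -> isomorphic H G.

(* gcdp is a gcd up to a nonzero constant factor; 'F_p is the field of p
   elements only for p prime. *)
Definition Phi (p n : nat) (G : sgraph n) : {poly 'F_p} :=
  gcdp (char_poly (adj_mx 'F_p G)) (char_poly (adj_mx 'F_p G + const_mx 1)).

(* Main.v *)
(* Let [H] have the generalized spectrum of [G], with walk matrices [W1] of [G]
   and [W2] of [H].  Then [W1^T W1 = W2^T W2], so that [Q = W1 W2^-1] is a rational
   orthogonal matrix fixing the all-one vector and conjugating one adjacency
   matrix into the other.  Let [U = l Q] be integral, and suppose that [U] is
   nonzero modulo some prime [p] dividing [l]; it remains to exclude this.

   Modulo [p] the columns of [U] span a totally isotropic [A]-invariant subspace
   orthogonal to the all-one vector.  If [f] is the characteristic polynomial of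
   [A] on it, then [f ^ 2] divides those of [A] and of [A + J], hence [Phi_p].
   The discriminant is, up to sign, the determinant of [chi'(A)], and [chi'(A)]
   kills this subspace modulo [p] while [u^T chi'(A) u] vanishes modulo [p ^ 2]
   for each column [u] of [U]; this forces [p ^ 2] to divide the discriminant.
   Also [p ^ 2] divides [det W1]: otherwise the kernels of [W1] and [W2] modulo
   [p] are lines, in fact the same line, and the argument above applies to [W1].
   So for [p] odd [p ^ 2] divides [theta G], against the squarefreeness of
   [Phi_p].  For [p = 2], computing with walk counts modulo 4 shows that
   [2 ^ (n/2 + 1)] divides [det W1], so [theta G] is even. *)
Require Import Defs.
From mathcomp Require Import all_boot all_order all_algebra all_field.
From mathcomp Require Import ring lra zify.
Set Implicit Arguments.
Unset Strict Implicit.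
Unset Printing Implicit Defensive.
Import Order.TTheory GRing.Theory Num.Theory.
Local Open Scope ring_scope.

(** * Integer matrices modulo a prime *)

Notation redmx p M := (map_mx (intr : int -> 'F_p) M).

Section ReductionModP.
Variables (p : nat) (p_pr : prime p).

Lemma intr_Fp_eq0 (x : int) : (x%:~R == 0 :> 'F_p) = (p%:Z %| x)%Z.
Proof. by rewrite (dvdz_pcharf (pchar_Fp p_pr)). Qed.

Lemma intr_FpP (x : int) : reflect (x%:~R = 0 :> 'F_p) (p%:Z %| x)%Z.
Proof. by rewrite -intr_Fp_eq0; apply: eqP. Qed.

Lemma redmx_eq0P m n (M : 'M[int]_(m, n)) :
  reflect (forall i j, (p%:Z %| M i j)%Z) (redmx p M == 0).
Proof.
apply: (iffP eqP) => [M0 i j | dM].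
  by move/matrixP/(_ i j): M0; rewrite !mxE => /intr_FpP.
by apply/matrixP=> i j; rewrite !mxE; apply/intr_FpP.
Qed.

Lemma redmx_neq0P m n (M : 'M[int]_(m, n)) :
  redmx p M != 0 -> exists i, exists j, ~~ (p%:Z %| M i j)%Z.
Proof.
move=> M0; have: [exists i, exists j, ~~ (p%:Z %| M i j)%Z].
  apply: contraNT M0; rewrite negb_exists => /forallP nM.
  apply/redmx_eq0P => i j; have := nM i; rewrite negb_exists => /forallP /(_ j).
  by rewrite negbK.
by move=> /existsP [i /existsP [j ij]]; exists i, j.
Qed.

Definition liftmx m n (M : 'M['F_p]_(m, n)) : 'M[int]_(m, n) :=
  map_mx (fun x : 'F_p => (x : nat)%:Z) M.

Lemma liftmxK m n (M : 'M['F_p]_(m, n)) : redmx p (liftmx M) = M.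
Proof. by apply/matrixP=> i j; rewrite !mxE; exact: natr_Zp. Qed.

Lemma redmx0_quot m n (M : 'M[int]_(m, n)) :
  redmx p M = 0 -> exists M', M = p%:Z *: M'.
Proof.
move/eqP/redmx_eq0P=> dM; exists (map_mx (divz^~ p%:Z) M).
by apply/matrixP=> i j; rewrite !mxE mulrC divzK.
Qed.


(** Laplace expansion along row [i]: its cofactors avoid that row, so they are those of [N]. *)
Lemma det_replace_row (R : comNzRingType) n (N : 'M[R]_n) (u : 'rV_n) i :
  \det (\matrix_(k, l) if k == i then u 0 l else N k l) = (u *m \adj N) 0 i.
Proof.
set N1 := \matrix_(k, l) _; rewrite (expand_det_row _ i) mxE.
apply: eq_bigr => k _; rewrite !mxE eqxx; congr (_ * (_ * \det _)).
by apply/matrixP => r s; rewrite !mxE eq_sym (negPf (neq_lift _ _)).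
Qed.

(* Replacing row [i] of [N] by [u N], then column [j] by the image of [a],
   turns row [i] and column [j] into multiples of [p], with corner [u N a]. *)
Lemma dvdz_sqr_det n (N : 'M[int]_n) (u : 'rV_n) (a : 'cV_n) :
    redmx p u != 0 -> redmx p a != 0 ->
    redmx p (u *m N) = 0 -> redmx p (N *m a) = 0 ->
    (p%:Z ^+ 2 %| ((u *m N *m a) 0 0)%R)%Z ->
  (p%:Z ^+ 2 %| \det N)%Z.
Proof.
move=> /redmx_neq0P[i0 [i]]; rewrite [i0]ord1 => ui {i0}.
move=> /redmx_neq0P[j [j0]]; rewrite [j0]ord1 => aj {j0}.
move=> /eqP/redmx_eq0P uN0 /eqP/redmx_eq0P Na0 uNa.
pose N1 : 'M_n := \matrix_(k, l) if k == i then (u *m N) 0 l else N k l.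
pose N2 : 'M_n := \matrix_(k, l) if k == j then ((N1 *m a)^T : 'rV_n) 0 l else N1^T k l.
have detN1 : \det N1 = u 0 i * \det N.
  by rewrite det_replace_row -mulmxA mul_mx_adj mul_mx_scalar mxE mulrC.
have detN2 : \det N2 = a j 0 * \det N1.
  rewrite det_replace_row trmx_mul -mulmxA mul_mx_adj mul_mx_scalar det_tr.
  by rewrite !mxE mulrC.
have N1a k : (N1 *m a) k 0 = if k == i then (u *m N *m a) 0 0 else (N *m a) k 0.
  by case: ifP => ki; rewrite !mxE; apply: eq_bigr => l _; rewrite !mxE ki.
have N2i k : k != j -> (p%:Z %| N2 k i)%Z.
  by move=> /negPf kj; rewrite mxE kj mxE mxE eqxx uN0.
have N2j k : k != i -> (p%:Z %| N2 j k)%Z.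
  by move=> /negPf ki; rewrite mxE eqxx mxE N1a ki.
have : (p%:Z ^+ 2 %| \det N2)%Z.
  (* The transposition in [N2] puts the corner at [(j, i)]. For any other [k], both the entry and
     column [i] of its minor are multiples of [p]. *)
  rewrite (expand_det_row _ j) rpred_sum // => k _.
  have [-> | ki] := eqVneq k i.
    by rewrite mxE eqxx mxE N1a eqxx dvdz_mulr.
  rewrite expr2 dvdz_mul ?N2j //.
  rewrite /cofactor dvdz_mull //.
  have [i' ii'|ik] := unliftP k i; last by rewrite ik eqxx in ki.
  rewrite (expand_det_col _ i') rpred_sum // => l _.
  by rewrite dvdz_mulr // mxE mxE -ii' N2i // eq_sym neq_lift.
have pco x : ~~ (p%:Z %| x)%Z -> coprimez (p%:Z ^+ 2) x.
  by move=> px; rewrite coprimezXl // coprimezE /= prime_coprime.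
by rewrite detN2 detN1 Gauss_dvdzr ?pco // Gauss_dvdzr ?pco.
Qed.

End ReductionModP.

(** * Square divisors of the walk determinant *)

Section WalkDeterminant.
Variables (p : nat) (p_pr : prime p).

(** The functional [w = u N / p] is injective modulo [p] on the kernel of [N], since a lifted kernel
    vector killed by it meets the hypotheses of [dvdz_sqr_det]. So the kernel has dimension at most
    1. *)
Lemma red_ker_line n (N : 'M[int]_n) (u : 'rV_n) (a b : 'cV['F_p]_n) :
    ~~ (p%:Z ^+ 2 %| \det N)%Z -> redmx p u != 0 -> redmx p (u *m N) = 0 ->
    redmx p N *m a = 0 -> redmx p N *m b = 0 -> a != 0 ->
  exists c, b = c *: a.
Proof.
move=> p2N u0 uN0 Na0 Nb0 a0.
have T (v : 'cV[int]_n) : redmx p (N *m v) = 0 ->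
    (p%:Z ^+ 2 %| ((u *m N *m v) 0 0)%R)%Z -> redmx p v = 0.
  move=> Nv uNv; apply: contraNeq p2N => v0; exact: (dvdz_sqr_det p_pr u0 v0).
have lNa : redmx p (N *m liftmx a) = 0 by rewrite map_mxM liftmxK.
have lNb : redmx p (N *m liftmx b) = 0 by rewrite map_mxM liftmxK.
have [w uN] := redmx0_quot p_pr uN0.
pose s := (w *m liftmx a) 0 0; pose t := (w *m liftmx b) 0 0.
have es : (u *m N *m liftmx a) 0 0 = p%:Z * s by rewrite uN -scalemxAl mxE.
have et : (u *m N *m liftmx b) 0 0 = p%:Z * t by rewrite uN -scalemxAl mxE.
have s0 : s%:~R != 0 :> 'F_p.
  apply: contraNneq a0 => /(intr_FpP p_pr) ps.
  by rewrite -(liftmxK a) T // es expr2 dvdz_mul.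
(* [w] takes the value [t s - s t = 0] on this combination. *)
have : redmx p (t *: liftmx a - s *: liftmx b) = 0.
  apply: T.
    by rewrite mulmxBr -!scalemxAr map_mxB !map_mxZ lNa lNb !scaler0 subr0.
  have -> : (u *m N *m (t *: liftmx a - s *: liftmx b)) 0 0 = 0; last exact: dvdz0.
  rewrite mulmxBr -!scalemxAr; move: es et.
  set x := u *m N *m liftmx a; set y := u *m N *m liftmx b => es et.
  by rewrite mxE [X in X + _]mxE [X in _ + X]mxE [X in - X]mxE es et; ring.
rewrite map_mxB !map_mxZ !liftmxK => /eqP; rewrite subr_eq0 => /eqP tasb.
by exists (t%:~R / s%:~R); rewrite mulrC -scalerA tasb scalerA mulVf // scale1r.
Qed.

(** By [red_ker_line] for [W^T], with a lift of [a] as left kernel vector, the kernel of [W^T]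
    modulo [p] is the line of [z], and the columns of [V] lie on it. *)
Lemma eigen_of_ker_line n (W A V : 'M[int]_n) (a z : 'cV['F_p]_n) nu :
    ~~ (p%:Z ^+ 2 %| \det W)%Z -> a != 0 -> redmx p W *m a = 0 ->
    (redmx p W)^T *m redmx p V = 0 ->
    z != 0 -> (redmx p W)^T *m z = 0 -> redmx p A *m z = nu *: z ->
  redmx p A *m redmx p V = nu *: redmx p V.
Proof.
move=> p2W a0 Wa WV z0 Wz Az.
have p2WT : ~~ (p%:Z ^+ 2 %| \det W^T)%Z by rewrite det_tr.
have u0 : redmx p (liftmx a)^T != 0 by rewrite -map_trmx liftmxK trmx_eq0.
have uW : redmx p ((liftmx a)^T *m W^T) = 0.
  by rewrite -trmx_mul -map_trmx map_mxM liftmxK Wa trmx0.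
rewrite map_trmx in WV Wz.
apply/trmx_inj/row_matrixP=> j; rewrite -!tr_col; congr trmx.
have [|c Vj] := red_ker_line p2WT u0 uW Wz (b := col j (redmx p V)) _ z0.
  by rewrite colE mulmxA WV mul0mx.
by rewrite linearZ /= colE -mulmxA -colE Vj -scalemxAr Az scalerA mulrC -scalerA.
Qed.

(** If not, the kernels of [W1] and [W2] modulo [p] are [C]-stable lines, spanned by eigenvectors
    [a] and [b] for [mu] and [nu]. The columns of [U] lie on the line of [W1 b] and those of [U^T]
    on that of [W2 a], so [A U = nu U] and [B U^T = mu U^T]. Then [mu = nu], and [b] is a multiple
    of [a] although [W1 b] is nonzero. *)
Lemma dvdz_sqr_det_intertwined n (W1 W2 U A B C : 'M[int]_n) (l : int) :
    (p%:Z %| l)%Z -> redmx p U != 0 ->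
    A^T = A -> B^T = B -> W1^T *m W1 = W2^T *m W2 ->
    A *m W1 = W1 *m C -> B *m W2 = W2 *m C -> A *m U = U *m B ->
    U^T *m W1 = l *: W2 -> U *m W2 = l *: W1 ->
    (forall mu (a b : 'cV['F_p]_n), redmx p C *m a = mu *: a ->
       redmx p C *m b = mu *: b -> a != 0 -> exists c, b = c *: a) ->
  (p%:Z ^+ 2 %| \det W1)%Z.
Proof.
move=> pl U0 Asym Bsym WW AW BW AU UW1 UW2 Cline; apply/negPn/negP=> p2W1.
have dW : `|\det W1|%N = `|\det W2|%N.
  have /(congr1 absz) := congr1 (@determinant _ _) WW.
  by rewrite !det_mulmx !det_tr !abszM !mulnn => /eqP; rewrite eqn_sqr => /eqP.
have p2W2 : ~~ (p%:Z ^+ 2 %| \det W2)%Z by move: p2W1; rewrite !dvdzE dW.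
have redl (M : 'M[int]_n) : redmx p (l *: M) = 0.
  by rewrite map_mxZ; move/(intr_FpP p_pr): pl => /= ->; rewrite scale0r.
have [i0 [j0 Uij]] := redmx_neq0P p_pr U0.
pose u := row i0 U; pose v := row j0 U^T.
have u0 : redmx p u != 0.
  apply: contraNneq Uij => /eqP /(redmx_eq0P p_pr) /(_ 0 j0); by rewrite mxE.
have v0 : redmx p v != 0.
  apply: contraNneq Uij => /eqP /(redmx_eq0P p_pr) /(_ 0 i0); by rewrite !mxE.
have uW2 : u *m W2 = row i0 (l *: W1) by rewrite -UW2 row_mul.
have vW1 : v *m W1 = row j0 (l *: W2) by rewrite -UW1 row_mul.
have ruW2 : redmx p (u *m W2) = 0 by rewrite uW2 map_row redl row0.
have rvW1 : redmx p (v *m W1) = 0 by rewrite vW1 map_row redl row0.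
have ker (W : 'M[int]_n) (x : 'rV_n) : redmx p x != 0 -> redmx p (x *m W) = 0 ->
    exists2 a : 'cV_n, a != 0 & redmx p W *m a = 0.
  move=> x0 xW; have : \det (redmx p W)^T == 0.
    rewrite det_tr; apply/det0P; exists (redmx p x) => //.
    by rewrite -map_mxM.
  case/det0P => a a0 aW; exists a^T; first by rewrite trmx_eq0.
  by rewrite -[LHS]trmxK trmx_mul trmxK aW trmx0.
have [a a0 W1a] := ker _ _ v0 rvW1; have [b b0 W2b] := ker _ _ u0 ruW2.
have [L lL] : exists L, l = p%:Z * L.
  by case/dvdzP: pl => L ->; exists L; rewrite mulrC.
(* Otherwise [v W1 a], which is [l] times an entry of [W2 a], is divisible by [p ^ 2]: one factor
   from [l], one from [W2 a]. *)
have W2a : redmx p W2 *m a != 0.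
  apply: contraNneq p2W1 => W2a.
  apply: (dvdz_sqr_det p_pr v0 (a := liftmx a)); rewrite ?liftmxK //.
    by rewrite map_mxM liftmxK.
  have /(redmx0_quot p_pr) [y ey] : redmx p (W2 *m liftmx a) = 0.
    by rewrite map_mxM liftmxK.
  rewrite vW1 -row_mul -scalemxAl ey !mxE lL expr2 mulrACA.
  exact: dvdz_mulr.
have W1b : redmx p W1 *m b != 0.
  apply: contraNneq p2W2 => W1b.
  apply: (dvdz_sqr_det p_pr u0 (a := liftmx b)); rewrite ?liftmxK //.
    by rewrite map_mxM liftmxK.
  have /(redmx0_quot p_pr) [y ey] : redmx p (W1 *m liftmx b) = 0.
    by rewrite map_mxM liftmxK.
  rewrite uW2 -row_mul -scalemxAl ey !mxE lL expr2 mulrACA.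
  exact: dvdz_mulr.
have rAW : redmx p A *m redmx p W1 = redmx p W1 *m redmx p C by rewrite -!map_mxM AW.
have rBW : redmx p B *m redmx p W2 = redmx p W2 *m redmx p C by rewrite -!map_mxM BW.
have [mu Ca] : exists mu, redmx p C *m a = mu *: a.
  apply: (red_ker_line p2W1 v0 rvW1 W1a _ a0).
  by rewrite mulmxA -rAW -mulmxA W1a mulmx0.
have [nu Cb] : exists nu, redmx p C *m b = nu *: b.
  apply: (red_ker_line p2W2 u0 ruW2 W2b _ b0).
  by rewrite mulmxA -rBW -mulmxA W2b mulmx0.
have rWW : (redmx p W1)^T *m redmx p W1 = (redmx p W2)^T *m redmx p W2.
  by rewrite !map_trmx -!map_mxM WW.
have tWV (W V X : 'M[int]_n) : V^T *m W = l *: X -> (redmx p W)^T *m redmx p V = 0.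
  by move=> VW; rewrite -[redmx p V]trmxK -trmx_mul !map_trmx -map_mxM VW redl trmx0.
have AU_mu : redmx p A *m redmx p U = nu *: redmx p U.
  apply: (eigen_of_ker_line p2W1 a0 W1a (tWV _ _ _ UW1) W1b).
    by rewrite mulmxA rWW -mulmxA W2b mulmx0.
  by rewrite mulmxA rAW -mulmxA Cb -scalemxAr.
have BU_mu : redmx p B *m redmx p U^T = mu *: redmx p U^T.
  have UTW2 : (U^T)^T *m W2 = l *: W1 by rewrite trmxK.
  apply: (eigen_of_ker_line p2W2 b0 W2b (tWV _ _ _ UTW2) W2a).
    by rewrite mulmxA -rWW -mulmxA W1a mulmx0.
  by rewrite mulmxA rBW -mulmxA Ca -scalemxAr.
have : (nu - mu) *: redmx p U = 0.
  rewrite scalerBl -AU_mu -map_mxM AU.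
  apply/eqP; rewrite subr_eq0; apply/eqP/trmx_inj.
  by rewrite map_trmx trmx_mul Bsym map_mxM BU_mu linearZ /= map_trmx.
move/eqP; rewrite scaler_eq0 (negPf U0) orbF subr_eq0 => /eqP nu_mu.
have [c bca] := Cline mu a b Ca (etrans Cb (congr1 (fun x => x *: b) nu_mu)) a0.
by rewrite bca -scalemxAr W1a scaler0 eqxx in W1b.
Qed.

End WalkDeterminant.

(** * Totally isotropic invariant subspaces *)

Section InvariantSubspace.
Variable F : fieldType.

Lemma char_poly_intertwined n (P M N : 'M[F]_n) :
  P \in unitmx -> P *m M = N *m P -> char_poly M = char_poly N.
Proof.
move=> Pu PM; have P0 : \det (map_mx polyC P) != 0.
  by rewrite det_map_mx polyC_eq0 -unitfE -unitmxE.
apply: (mulfI P0); rewrite [RHS]mulrC -!det_mulmx; congr (\det _).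
rewrite /char_poly_mx mulmxBr mulmxBl -!map_mxM PM.
by rewrite mul_mx_scalar mul_scalar_mx.
Qed.

Lemma char_poly_lblock k l (R : 'M[F]_k) (C : 'M_(l, k)) (S : 'M_l) :
  char_poly (block_mx R 0 C S) = char_poly R * char_poly S.
Proof.
rewrite /char_poly /char_poly_mx map_block_mx map_mx0 scalar_mx_block.
by rewrite opp_block_mx add_block_mx oppr0 !add0r det_lblock.
Qed.

Lemma char_poly_trmx n (M : 'M[F]_n) : char_poly M^T = char_poly M.
Proof.
rewrite /char_poly -det_tr; congr (\det _).
by rewrite /char_poly_mx linearB /= tr_scalar_mx -map_trmx trmxK.
Qed.

Lemma row_free_complete k l (V : 'M[F]_(k, k + l)) :
  row_free V -> exists2 P, P \in unitmx & V = row_mx 1%:M 0 *m P.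
Proof.
move=> Vfree; pose L := col_ebase V; pose E := row_ebase V.
exists (block_mx L 0 0 1%:M *m E).
  rewrite unitmx_mul row_ebase_unit andbT unitmxE det_lblock det1 mulr1.
  by rewrite -unitmxE col_ebase_unit.
rewrite -{1}(mulmx_ebase V) (eqP Vfree) mulmxA mul_row_block !mul1mx !mul0mx.
rewrite !addr0; congr (_ *m _); rewrite pid_mx_row.
by rewrite mul_mx_row mulmx1 mulmx0.
Qed.

Lemma invariant_block k l (V : 'M[F]_(k, k + l)) (M : 'M_(k + l)) (R : 'M_k) :
    row_free V -> V *m M = R *m V ->
  exists P C S, [/\ P \in unitmx, V = row_mx 1%:M 0 *m P
                  & P *m M = block_mx R 0 C S *m P].
Proof.
move=> /row_free_complete [P Pu defV] VM; pose N := P *m M *m invmx P.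
exists P, (dlsubmx N), (drsubmx N); split=> //.
have: row_mx 1%:M 0 *m N = row_mx R 0.
  rewrite /N !mulmxA -defV VM defV -!mulmxA mulmxV // mulmx1.
  by rewrite mul_mx_row mulmx1 mulmx0.
rewrite -{1}(submxK N) mul_row_block !mul1mx !mul0mx !addr0.
move/eq_row_mx=> [Nul Nur].
by rewrite -{1}Nul -Nur submxK /N -!mulmxA mulVmx // mulmx1.
Qed.

Lemma char_poly_invariant_dvd n k (V : 'M[F]_(k, n)) (M : 'M_n) (R : 'M_k) :
  row_free V -> V *m M = R *m V -> char_poly R %| char_poly M.
Proof.
move=> Vfree VM; have kn : (k <= n)%N by rewrite -(eqP Vfree) rank_leq_col.
move: M V VM Vfree; rewrite -(subnKC kn) => M V VM Vfree.
have [P [C [S [Pu _ PM]]]] := invariant_block Vfree VM.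
by rewrite (char_poly_intertwined Pu PM) char_poly_lblock dvdp_mulr.
Qed.

(* If [V] is totally isotropic, [M] acts on the quotient by the orthogonal of
   [V] as on the dual of [V], which gives the second factor. *)
Lemma char_poly_isotropic_dvd n k (V : 'M[F]_(k, n)) (M : 'M_n) (R : 'M_k) :
    M^T = M -> V *m V^T = 0 -> row_free V -> V *m M = R *m V ->
  char_poly R ^+ 2 %| char_poly M.
Proof.
move=> Msym VV Vfree VM; have kn : (k <= n)%N by rewrite -(eqP Vfree) rank_leq_col.
move: M V VM Vfree Msym VV; rewrite -(subnKC kn) => M V VM Vfree Msym VV.
have [P [C [S [Pu defV PM]]]] := invariant_block Vfree VM.
rewrite (char_poly_intertwined Pu PM) char_poly_lblock expr2 dvdp_mul //.
(* The upper part of [P V^T] is [V V^T = 0]. The lower part [Y] intertwines [S] with [R^T] and has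
   full column rank, so [char_poly R] divides [char_poly S]. *)
pose Y := dsubmx (P *m V^T).
have PV : P *m V^T = col_mx 0 Y.
  rewrite -[LHS]vsubmxK; congr col_mx.
  transitivity (row_mx 1%:M 0 *m (P *m V^T)); last by rewrite mulmxA -defV.
  by rewrite -{2}[P *m V^T]vsubmxK mul_row_col mul1mx mul0mx addr0.
have MV : M *m V^T = V^T *m R^T by rewrite -trmx_mul -VM trmx_mul Msym.
have SY : S *m Y = Y *m R^T.
  have : block_mx R 0 C S *m (P *m V^T) = P *m V^T *m R^T.
    by rewrite mulmxA -PM -!mulmxA MV.
  rewrite PV mul_block_col mul_col_mx !mulmx0 !mul0mx !add0r.
  by case/eq_col_mx.
have Yfree : row_free Y^T.
  rewrite /row_free mxrank_tr; have : \rank (P *m V^T) = k.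
    by rewrite eqmxMfull ?row_full_unit // mxrank_tr; exact/eqP.
  by rewrite PV rank_col_0mx => ->.
rewrite -(char_poly_trmx S); apply: (char_poly_invariant_dvd Yfree).
by rewrite -trmx_mul SY trmx_mul trmxK.
Qed.

End InvariantSubspace.

Lemma horner_mx_intertwined (R : comNzRingType) k n (V : 'M[R]_(k.+1, n.+1))
    (S : 'M_k.+1) (M : 'M_n.+1) (q : {poly R}) :
  V *m M = S *m V -> V *m horner_mx M q = horner_mx S q *m V.
Proof.
move=> VM; elim/poly_ind: q => [|q c IHq]; first by rewrite !rmorph0 mulmx0 mul0mx.
rewrite !rmorphD !rmorphM /= !horner_mx_X !horner_mx_C mulmxDr mulmxDl.
rewrite -!mulmxE mulmxA IHq -!mulmxA VM; congr (_ + _).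
by rewrite mul_mx_scalar mul_scalar_mx.
Qed.

Lemma horner_mx_trmx (R : comNzRingType) n (M : 'M[R]_n.+1) (q : {poly R}) :
  (horner_mx M q)^T = horner_mx M^T q.
Proof.
elim/poly_ind: q => [|q c IHq]; first by rewrite !rmorph0 trmx0.
rewrite !rmorphD !rmorphM /= !horner_mx_X !horner_mx_C linearD /= tr_scalar_mx.
rewrite -!mulmxE trmx_mul IHq !mulmxE; congr (_ + _).
by rewrite -{1}(horner_mx_X M^T) -rmorphM /= mulrC rmorphM /= horner_mx_X.
Qed.

(** [f] is the characteristic polynomial of [M] on the row space of [X], where [M + J] acts as [M]
    does because [J] vanishes there. The last clause is Cayley-Hamilton on that space. *)
Lemma isotropic_invariant_factor (F : fieldType) n (X N M J : 'M[F]_n.+1) :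
    X != 0 -> X *m X^T = 0 -> X *m M = N *m X -> X *m J = 0 ->
    M^T = M -> J^T = J ->
  exists f : {poly F}, [/\ (1 < size f)%N, f ^+ 2 %| char_poly M,
    f ^+ 2 %| char_poly (M + J)
    & forall q, f %| q -> X *m horner_mx M q = 0].
Proof.
move=> X0 XX XM XJ Msym Jsym.
pose V := row_base X; have Vfree : row_free V := row_base_free X.
have [D defV] : exists D, V = D *m X by apply/submxP; rewrite eq_row_base.
have [E defX] : exists E, X = E *m V by apply/submxP; rewrite eq_row_base.
have VV : V *m V^T = 0 by rewrite defV trmx_mul mulmxA -(mulmxA D) XX mulmx0 mul0mx.
have [R VM] : exists R, V *m M = R *m V.
  by apply/submxP; rewrite eq_row_base {1}defV -mulmxA XM mulmxA submxMl.
have VMJ : V *m (M + J) = R *m V.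
  by rewrite mulmxDr VM [V *m J](_ : _ = 0) ?addr0 // defV -mulmxA XJ mulmx0.
exists (char_poly R); rewrite size_char_poly ltnS lt0n mxrank_eq0; split=> //.
- exact: char_poly_isotropic_dvd VM.
- by apply: char_poly_isotropic_dvd VMJ => //; rewrite linearD /= Msym Jsym.
move=> q /dvdpP [g ->]; rewrite {1}defX -mulmxA.
suff -> : V *m horner_mx M (g * char_poly R) = 0 by rewrite mulmx0.
have: (0 < \rank X)%N by rewrite lt0n mxrank_eq0.
move: V R VM {defV VV VMJ defX Vfree D E}; case: (\rank X) => // k V R VM _.
by rewrite (horner_mx_intertwined _ VM) rmorphM /= Cayley_Hamilton mulr0 mul0mx.
Qed.

(** * Primes dividing the level *)

Section PrimeDividingLevel.
Variables (p : nat) (p_pr : prime p) (n : nat) (A B U : 'M[int]_n.+1) (l : int).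
Hypotheses (pl : (p%:Z %| l)%Z) (U0 : redmx p U != 0).
Hypotheses (UU : U^T *m U = (l ^+ 2)%:M) (Ue : U^T *m const_mx 1 = const_mx l :> 'cV_n.+1).
Hypotheses (Asym : A^T = A) (Bsym : B^T = B) (AU : A *m U = U *m B).

Lemma redl : l%:~R = 0 :> 'F_p.
Proof. exact/intr_FpP. Qed.

(** Take [X = U^T] modulo [p]: it is isotropic because [U^T U = l ^ 2], and it kills the all-one
    matrix because it kills the all-one column. *)
Lemma red_factor : exists f : {poly 'F_p}, [/\ (1 < size f)%N,
    f ^+ 2 %| char_poly (redmx p A), f ^+ 2 %| char_poly (redmx p A + const_mx 1)
  & forall q, f %| q -> (redmx p U)^T *m horner_mx (redmx p A) q = 0].
Proof.
have rUA : (redmx p U)^T *m redmx p A = redmx p B *m (redmx p U)^T.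
  by rewrite map_trmx -!map_mxM -{1}Asym -trmx_mul AU trmx_mul Bsym.
apply: (isotropic_invariant_factor _ _ rUA).
- by rewrite trmx_eq0.
- rewrite trmxK map_trmx -map_mxM UU map_scalar_mx /= rmorphXn /= redl expr0n.
  by rewrite raddf0.
- have -> : const_mx 1 = redmx p (const_mx 1 : 'cV_n.+1) *m (const_mx 1 : 'rV_n.+1).
    by rewrite map_const_mx /= ; apply/matrixP=> i j; rewrite !mxE big_ord1 !mxE mulr1.
  by rewrite mulmxA map_trmx -map_mxM Ue map_const_mx /= redl mul0mx.
- by rewrite map_trmx Asym.
- exact: trmx_const.
Qed.

Lemma dvdz_sqr_det_deriv : (p%:Z ^+ 2 %| \det (horner_mx A (char_poly A)^`()))%Z.
Proof.
have [f [_ fA _ fU]] := red_factor.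
set q := (char_poly A)^`(); set N := horner_mx A q.
have rUN : redmx p (U^T *m N) = 0.
  (* Modulo [p], [f ^ 2] divides the characteristic polynomial, so [f] divides its derivative and
     [fU] applies. *)
  rewrite map_mxM -map_trmx map_horner_mx fU // -deriv_map map_char_poly.
  case/dvdpP: fA => g ->; rewrite expr2 mulrA derivM.
  by rewrite dvdp_add ?dvdp_mulIr // -mulrA mulrCA dvdp_mulIl.
have Nsym : N^T = N.
  by rewrite /N horner_mx_trmx Asym.
(* The diagonal entries of this product are the corners required by [dvdz_sqr_det]. *)
have UNU : U^T *m N *m U = l ^+ 2 *: horner_mx B q.
  have UA : U^T *m A = B *m U^T by rewrite -{1}Asym -trmx_mul AU trmx_mul Bsym.
  by rewrite (horner_mx_intertwined _ UA) -mulmxA UU mul_mx_scalar.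
have [i [j Uij]] := redmx_neq0P p_pr U0.
have rc : redmx p (N *m U) = 0.
  by rewrite -[N *m U]trmxK trmx_mul Nsym -map_trmx rUN trmx0.
apply: (dvdz_sqr_det p_pr (u := row j U^T) (a := col j U)).
- by apply: contraNneq Uij => /eqP /(redmx_eq0P p_pr) /(_ 0 i); rewrite !mxE.
- by apply: contraNneq Uij => /eqP /(redmx_eq0P p_pr) /(_ i 0); rewrite !mxE.
- by rewrite -row_mul map_row rUN row0.
- by rewrite colE mulmxA -colE map_col rc col0.
rewrite -row_mul colE mulmxA -row_mul UNU -colE mxE mxE mxE.
by rewrite dvdz_mulr // dvdz_exp2r.
Qed.

End PrimeDividingLevel.

Lemma not_squarefree_gcdp (F : fieldType) (f g h : {poly F}) :
    (1 < size f)%N -> g != 0 -> f ^+ 2 %| g -> f ^+ 2 %| h ->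
  ~~ coprimep (gcdp g h) (gcdp g h)^`().
Proof.
move=> sf g0 fg fh; have : f ^+ 2 %| gcdp g h by rewrite dvdp_gcd fg.
have : gcdp g h != 0 by rewrite gcdp_eq0 negb_and g0.
move: (gcdp g h) => d d0 /dvdpP [c defd]; rewrite coprimep_def neq_ltn.
apply/orP; right; apply: leq_trans sf _; apply: dvdp_leq.
  by rewrite gcdp_eq0 negb_and d0.
rewrite defd dvdp_gcd expr2 mulrA dvdp_mulIr derivM.
by rewrite dvdp_add ?dvdp_mulIr // -mulrA mulrCA dvdp_mulIl.
Qed.

Lemma trmx_adj_mx (R : nzRingType) n (G : sgraph n) : (adj_mx R G)^T = adj_mx R G.
Proof. by apply/matrixP=> i j; rewrite !mxE adj_sym. Qed.

Lemma adj_mx_diag (R : nzRingType) n (G : sgraph n) i : adj_mx R G i i = 0.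
Proof. by rewrite mxE adj_irrefl. Qed.

Lemma map_adj_mx (R S : nzRingType) (f : {rmorphism R -> S}) n (G : sgraph n) :
  map_mx f (adj_mx R G) = adj_mx S G.
Proof. by apply/matrixP=> i j; rewrite !mxE rmorph_nat. Qed.

Lemma Phi_not_squarefree p n (G : sgraph n.+1) (B U : 'M[int]_n.+1) (l : int) :
    prime p -> (p%:Z %| l)%Z -> redmx p U != 0 -> U^T *m U = (l ^+ 2)%:M ->
    U^T *m const_mx 1 = const_mx l :> 'cV_n.+1 -> B^T = B ->
    adj_mx int G *m U = U *m B ->
  ~~ coprimep (Phi p G) (Phi p G)^`().
Proof.
move=> p_pr pl U0 UU Ue Bsym AU.
have [f [sf]] := red_factor p_pr pl U0 UU Ue (trmx_adj_mx int G) Bsym AU.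
rewrite map_adj_mx => fA fAJ _.
by apply: (not_squarefree_gcdp sf _ fA fAJ); rewrite monic_neq0 ?char_poly_monic.
Qed.

(** * The discriminant *)

Lemma horner_char_poly (R : comNzRingType) n (A : 'M[R]_n) b :
  (char_poly A).[b] = \det (b%:M - A).
Proof.
rewrite -horner_evalE -det_map_mx; congr (\det _).
by apply/matrixP=> i j; rewrite !mxE /= horner_evalE !(hornerE, hornerMn).
Qed.

(** Both sides are multiplicative in [q], which splits into a constant and linear factors; for
    ['X - b] the determinant is [char_poly A] at [b] up to sign. *)
Lemma det_horner_mx (F : closedFieldType) n (A : 'M[F]_n.+1) (a : 'I_n.+1 -> F) q :
    char_poly A = \prod_i ('X - (a i)%:P) ->
  \det (horner_mx A q) = \prod_i q.[a i].
Proof.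
move=> chA; have [t ->] := closed_field_poly_normal q.
elim: t => [|b t IHt].
  rewrite big_nil alg_polyC horner_mx_C det_scalar -[in LHS](card_ord n.+1).
  by rewrite -prodr_const; apply: eq_bigr => i _; rewrite hornerC.
rewrite big_cons scalerAr rmorphM /= detM IHt.
have -> : \det (horner_mx A ('X - b%:P)) = \prod_i (a i - b).
  rewrite rmorphB /= horner_mx_X horner_mx_C -opprB -scaleN1r detZ.
  rewrite -horner_char_poly chA horner_prod -[X in _ ^+ X](card_ord n.+1) -prodr_const.
  by rewrite -big_split; apply: eq_bigr => i _ /=; rewrite !hornerE mulN1r opprB.
by rewrite -big_split; apply: eq_bigr => i _ /=; rewrite hornerM !hornerE.
Qed.

Lemma horner_deriv_prod_XsubC (R : comNzRingType) n (a : 'I_n -> R) i :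
  (\prod_j ('X - (a j)%:P))^`().[a i] = \prod_(j | j != i) (a i - a j).
Proof.
rewrite (bigD1 i) //= derivM derivXsubC mul1r hornerD hornerM hornerXsubC.
rewrite subrr mul0r addr0 horner_prod.
by apply: eq_bigr => j _; rewrite hornerXsubC.
Qed.

(** The pairs [(i, j)] and [(j, i)] together contribute [- (a i - a j) ^ 2]. *)
Lemma prod_offdiag (R : comNzRingType) n (a : 'I_n -> R) :
  exists s : int, s * s = 1 /\ 
  \prod_i \prod_(j | j != i) (a i - a j)
    = s%:~R * \prod_(i < n) \prod_(j < n | (j < i)%N) (a i - a j) ^+ 2.
Proof.
exists (\prod_(i < n) \prod_(j < n | (j < i)%N) (-1)); split.
  rewrite -big_split big1 // => i _ /=.
  by rewrite -big_split big1 // => j _ /=.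
rewrite rmorph_prod -big_split /=.
transitivity ((\prod_(i < n) \prod_(j < n | (j < i)%N) (a i - a j)) *
              (\prod_(i < n) \prod_(j < n | (i < j)%N) (a i - a j))).
  rewrite -big_split; apply: eq_bigr => i _ /=.
  rewrite (bigID (fun j : 'I_n => (j < i)%N)) /=; congr (_ * _); apply: eq_bigl => j.
    by rewrite -val_eqE /=; case: ltngtP.
  by rewrite -val_eqE /=; case: ltngtP.
rewrite [X in _ * X](exchange_big_dep predT) //= -big_split; apply: eq_bigr => i _ /=.
rewrite rmorph_prod -!big_split; apply: eq_bigr => j _ /=.
by ring.
Qed.

Lemma char_poly_spectrum n (G : sgraph n) :
  char_poly (adj_mx algC G) = \prod_(a <- spectrum G) ('X - a%:P).
Proof.
rewrite /spectrum; case: closed_field_poly_normal => s /= {1}->.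
by rewrite (monicP (char_poly_monic _)) scale1r.
Qed.

Lemma size_spectrum n (G : sgraph n) : size (spectrum G) = n.
Proof.
have := size_char_poly (adj_mx algC G).
by rewrite char_poly_spectrum size_prod_XsubC => -[].
Qed.

Lemma discriminantE n (G : sgraph n.+1) (A := adj_mx int G) :
  `|discriminant G|%N = `|\det (horner_mx A (char_poly A)^`())|%N.
Proof.
set N := \det _; have := char_poly_spectrum G.
rewrite (big_nth 0) size_spectrum big_mkord => chA.
have := det_horner_mx (char_poly (adj_mx algC G))^`() chA.
rewrite -(map_adj_mx (intr : {rmorphism int -> algC})).
rewrite -map_char_poly deriv_map -map_horner_mx det_map_mx /= -/A -/N.
rewrite -deriv_map map_char_poly map_adj_mx chA.
under eq_bigr do rewrite horner_deriv_prod_XsubC.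
have [s [ss ->]] := prod_offdiag (fun i : 'I_n.+1 => (spectrum G)`_i) => defN.
(* The product in [discriminant] is the image of the integer [s * N], so [Num.floor] is exact on
   it. *)
have -> : discriminant G = s * N.
  rewrite /discriminant -[RHS](@intrKfloor algC) rmorphM /= defN mulrA -rmorphM.
  by rewrite ss mul1r.
rewrite abszM; have /(congr1 absz) := ss; rewrite abszM => /eqP.
by rewrite muln_eq1 => /andP[/eqP-> _]; rewrite mul1n.
Qed.

(** * Walk counts and the generalized spectrum *)

(** Matrix determinant lemma: [\det K] is computed by column operations clearing [- v], then by
    others clearing [u], which multiply it by [\det M]. *)
Lemma det_add_rank1 (R : idomainType) n (M : 'M[R]_n) (u : 'cV_n) (v : 'rV_n) :
  \det M != 0 -> \det (M + u *m v) = \det M + (v *m \adj M *m u) 0 0.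
Proof.
move=> M0; pose K := block_mx M u (- v) 1%:M.
have : \det (K *m block_mx 1%:M 0 v 1%:M) = \det (M + u *m v).
  rewrite mulmx_block !mulmx1 !mulmx0 !mul1mx add0r addNr add0r.
  by rewrite det_ublock det1 mulr1.
rewrite det_mulmx det_lblock !det1 !mulr1 => <-; apply: (mulIf M0).
have : \det (K *m block_mx 1%:M (- (\adj M *m u)) 0 (\det M)%:M) = \det K * \det M.
  by rewrite det_mulmx det_ublock det1 mul1r det_scalar1.
have MAu : M *m - (\adj M *m u) = - (\det M *: u).
  by rewrite mulmxN mulmxA mul_mx_adj mul_scalar_mx.
move=> <-; rewrite mulmx_block !mulmx1 !mulmx0 !addr0 MAu mul_mx_scalar addNr.
rewrite det_lblock mulrC; congr (_ * _).
by rewrite det_mx11 mul1mx mulNmx mulmxN opprK addrC mulmxA mxE mxE eqxx.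
Qed.

Lemma size_det_linear (R : nzRingType) n (M : 'M[{poly R}]_n) :
  (forall i j, size (M i j) <= 2)%N -> (size (\det M) <= n.+1)%N.
Proof.
move=> sM; rewrite /determinant.
apply: (big_ind (fun p : {poly R} => size p <= n.+1)%N); first by rewrite size_poly0.
  by move=> p q sp sq; rewrite (leq_trans (size_polyD _ _)) // geq_max sp sq.
move=> s _; rewrite mulr_sign (fun_if (fun p : {poly R} => size p)) size_polyN if_same.
apply: (leq_trans (size_prod_leq _ _)); rewrite card_ord /=.
rewrite leq_subLR; apply: leq_trans (_ : \sum_(i < n) 2 < _)%N; first exact: leq_sum.
by rewrite sum_nat_const card_ord; lia.
Qed.

Lemma size_sum_leq (R : nzRingType) (I : finType) (F : I -> {poly R}) m :
  (forall i, size (F i) <= m)%N -> (size (\sum_i F i)%R <= m)%N.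
Proof. by move=> Fm; apply: leq_trans (size_sum _ _ _) _; apply/bigmax_leqP. Qed.

Lemma horner_mx_sum (R : comNzRingType) n (A : 'M[R]_n.+1) (q : {poly R}) r :
  (size q <= r)%N -> horner_mx A q = \sum_(i < r) q`_i *: A ^+ i.
Proof.
move=> qr; rewrite -{1}[q]coefK (poly_def) rmorph_sum /=.
rewrite (big_ord_widen r (fun i => horner_mx A (q`_i *: 'X^i)) qr) big_mkcond.
apply: eq_bigr => i _; rewrite linearZ /= rmorphXn /= horner_mx_X.
by case: ifP => //; rewrite ltnNge => /negbFE qi; rewrite nth_default // scale0r.
Qed.

Section WalkCounts.
Variables (R : idomainType) (n : nat).
Notation ones := (const_mx 1).

Definition walks (A : 'M[R]_n.+1) k : R := ((ones : 'rV_n.+1) *m A ^+ k *m (ones : 'cV_n.+1)) 0 0.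

(** Numerator of the walk generating function: [e^T (x I - A)^-1 e = walk_num A / char_poly A]. *)
Definition walk_num (A : 'M[R]_n.+1) : {poly R} :=
  ((ones : 'rV_n.+1) *m \adj (char_poly_mx A) *m (ones : 'cV_n.+1)) 0 0.

Lemma det_char_poly_mx_add_ones (A : 'M[R]_n.+1) :
  \det (char_poly_mx A + ones) = char_poly A + walk_num A.
Proof.
have -> : ones = (ones : 'cV[{poly R}]_n.+1) *m (ones : 'rV_n.+1).
  by apply/matrixP=> i j; rewrite !mxE big_ord1 !mxE mulr1.
by rewrite det_add_rank1 // -/(char_poly A) monic_neq0 ?char_poly_monic.
Qed.

(** Substituting [-x - 1] for [x] turns [x I - (J - I - A)] into [-(x I - A + J)]. *)
Lemma char_poly_compl (A : 'M[R]_n.+1) :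
  char_poly (ones - 1%:M - A) \Po (- 'X - 1)
    = (-1) ^+ n.+1 * (char_poly A + walk_num A).
Proof.
rewrite -det_char_poly_mx_add_ones -detZ /char_poly.
rewrite -[_ \Po _]/(comp_poly (- 'X - 1) _) -det_map_mx; congr (\det _).
apply/matrixP=> i j; rewrite !mxE /= rmorphB rmorphMn /= comp_polyX comp_polyC.
by case: (i == j); rewrite !polyCB ?polyC0 ?mulr0n; ring.
Qed.

(** The expansion of [walk_num A / char_poly A] in [1/x], cut after [m] terms:
    [X^m - A^m = (X - A) S] is multiplied by the adjugate of [X - A] and taken between all-one
    vectors. The adjugate has entries of degree at most [n], which bounds [r]. *)
Lemma walk_seriesE (A : 'M[R]_n.+1) m : exists2 r : {poly R}, (size r <= n.+1)%N &
  char_poly A * (\sum_(k < m) 'X^(m.-1 - k) * (walks A k)%:P) = 'X^m * walk_num A - r.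
Proof.
pose Ap := map_mx polyC A; pose X : 'M[{poly R}]_n.+1 := 'X%:M.
pose P := \adj (char_poly_mx A); pose S := \sum_(k < m) X ^+ (m.-1 - k) * Ap ^+ k.
exists (((ones : 'rV_n.+1) *m P *m (Ap ^+ m *m (ones : 'cV_n.+1))) 0 0).
  rewrite mxE; apply: size_sum_leq => i; rewrite /Ap -rmorphXn /=.
  have -> : (map_mx polyC (A ^+ m) *m (ones : 'cV_n.+1)) i 0
      = ((A ^+ m *m (ones : 'cV_n.+1)) i 0)%:P.
    by rewrite !mxE rmorph_sum; apply: eq_bigr => j _; rewrite !mxE rmorphM.
  rewrite mulrC mul_polyC; apply: leq_trans (size_scale_leq _ _) _.
  rewrite mxE; apply: size_sum_leq => j; rewrite !mxE mul1r /cofactor -signr_odd mulr_sign.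
  rewrite (fun_if (fun p : {poly R} => size p)) size_polyN if_same.
  apply: size_det_linear => k l; rewrite !mxE.
  apply: leq_trans (size_polyD _ _) _; rewrite size_polyN geq_max size_polyC.
  by case: (_ == _); rewrite ?mulr1n ?mulr0n ?size_polyX ?size_poly0 //; case: (_ != _).
have XA : (X - Ap) * S = X ^+ m - Ap ^+ m.
  by rewrite subrXX_comm //; apply: comm_scalar_mx.
have : P *m ((X - Ap) *m S) = char_poly A *: S.
  by rewrite mulmxA mul_adj_mx mul_scalar_mx.
rewrite [(X - Ap) *m S]XA mulmxBr => PS.
have Xk k : X ^+ k = ('X^k)%:M by rewrite /X -rmorphXn.
have ApE k : Ap ^+ k = map_mx polyC (A ^+ k) by rewrite /Ap rmorphXn.
have wE k : ((ones : 'rV_n.+1) *m (X ^+ (m.-1 - k) * Ap ^+ k) *m (ones : 'cV_n.+1)) 0 0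
    = 'X^(m.-1 - k) * (walks A k)%:P.
  rewrite Xk -mulmxE mul_scalar_mx -scalemxAr -scalemxAl mxE ApE; congr (_ * _).
  by rewrite /walks -(map_const_mx polyC) -(map_const_mx polyC) -!map_mxM mxE.
have /(congr1 (fun M => ((ones : 'rV_n.+1) *m M *m (ones : 'cV_n.+1)) 0 0)) := PS.
rewrite mulmxBr mulmxBl mxE [X in _ + X]mxE Xk mul_mx_scalar -scalemxAr -scalemxAl.
rewrite mxE -/(walk_num A) !mulmxA => ->.
rewrite -scalemxAr -scalemxAl mxE /S mulmx_sumr mulmx_suml summxE; congr (_ * _).
by apply: eq_bigr => k _; rewrite wE.
Qed.

(** Once the shorter counts agree, [char_poly A] times the difference of the [m]-th ones has degree
    at most [n]; as [char_poly A] is monic of degree [n.+1], that difference is zero. *)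
Lemma eq_walks (A B : 'M[R]_n.+1) : char_poly A = char_poly B ->
  walk_num A = walk_num B -> forall k, walks A k = walks B k.
Proof.
move=> chAB nAB k; have [m] := ubnP k; elim: m k => [k|m IHm k]; first by rewrite ltn0.
rewrite ltnS leq_eqVlt => /predU1P[-> {k}|]; last exact: IHm.
have [r sr Er] := walk_seriesE A m.+1; have [s ss Es] := walk_seriesE B m.+1.
have : char_poly A * (walks A m - walks B m)%:P = s - r.
  move: Er Es; rewrite !big_ord_recr /= -chAB -nAB subnn expr0 !mul1r.
  rewrite (eq_bigr (fun i : 'I_m => 'X^(m - i) * (walks B i)%:P)) => [|i _]; last first.
    by rewrite (IHm _ (ltn_ord i)).
  set T := \sum_(_ < _) _ => Er Es.
  have: char_poly A * (T + (walks A m)%:P) - char_poly A * (T + (walks B m)%:P) = s - r.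
    by rewrite Er Es; ring.
  by move=> <-; rewrite polyCB; ring.
move/(congr1 (coefp n.+1)) => /=; rewrite coefMC coefB.
have := char_poly_monic A; rewrite monicE lead_coefE size_char_poly /= => /eqP ->.
rewrite mul1r (nth_default 0 ss) (nth_default 0 sr) subrr.
by move/eqP; rewrite subr_eq0 => /eqP.
Qed.
End WalkCounts.

(** * The prime 2 *)

(** Off-diagonal terms come in equal pairs. *)
Lemma dvdz2_sum_sym n (f : 'I_n -> 'I_n -> int) :
    (forall i j, f i j = f j i) ->
  (2 %| (\sum_i \sum_j f i j)%R - (\sum_i f i i)%R)%Z.
Proof.
move=> fsym.
have -> : \sum_i \sum_j f i j = \sum_i f i i + 2 * \sum_(i < n) \sum_(j < n | (j < i)%N) f i j.
  transitivity (\sum_i f i i + (\sum_(i < n) \sum_(j < n | (j < i)%N) f i j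
      + \sum_(i < n) \sum_(j < n | (i < j)%N) f i j)).
    rewrite -!big_split; apply: eq_bigr => i _ /=; rewrite (bigD1 i) //=; congr (_ + _).
    rewrite (bigID (fun j : 'I_n => (j < i)%N)) /=; congr (_ + _); apply: eq_bigl => j.
      by rewrite -val_eqE /=; case: ltngtP.
    by rewrite -val_eqE /=; case: ltngtP.
  congr (_ + _); rewrite mulr_natl mulr2n; congr (_ + _).
  rewrite [LHS](exchange_big_dep predT) //=; apply: eq_bigr => i _.
  by apply: eq_bigr => j _.
by rewrite addrAC subrr add0r dvdz_mulr.
Qed.

Lemma F2_cases (z : 'F_2) : (z == 0) || (z == 1).
Proof. by case: z => [[|[|]]]. Qed.

Lemma dvdz2_mul_pred (x : int) : (2 %| x * (x - 1))%Z.
Proof.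
apply/(@intr_FpP 2) => //; rewrite rmorphM rmorphB /=.
by case/orP: (F2_cases x%:~R) => /eqP ->; rewrite ?mul0r ?subrr ?mulr0.
Qed.

Lemma dvdz2_nat (m : nat) : (2 %| m%:Z)%Z = ~~ odd m.
Proof. by rewrite dvdzE /= dvdn2. Qed.

Lemma dvdz4_double (x : int) : (4 %| (2 * x)%R)%Z = (2 %| x)%Z.
Proof. exact: (@dvdz_mul2l 2 2 x). Qed.

Lemma sum_even_index (R : nmodType) n (F : nat -> R) :
  \sum_(j < n) (if odd j then 0 else F j./2) = \sum_(i < uphalf n) F i.
Proof.
elim: n => [|n IHn]; first by rewrite !big_ord0.
rewrite big_ord_recr /= IHn uphalf_half; case: odd; first by rewrite addr0.
by rewrite add0n big_ord_recr.
Qed.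

Section WalkMatrix.
Variables (n : nat) (A : 'M[int]_n.+1).
Hypotheses (Asym : A^T = A) (Adiag : forall i, A i i = 0).
Notation N := n.+1.
Notation e := (const_mx 1 : 'cV_N).
Notation w := (walks A).

Lemma trmx_expr k : (A ^+ k)^T = A ^+ k.
Proof.
elim: k => [|k IHk]; first by rewrite trmx1.
by rewrite exprS -mulmxE trmx_mul IHk Asym mulmxE -exprSr -exprS.
Qed.

Lemma walksE i j : ((A ^+ i *m e)^T *m (A ^+ j *m e)) 0 0 = w (i + j).
Proof. by rewrite /walks trmx_mul trmx_expr trmx_const mulmxA exprD -mulmxE !mulmxA. Qed.

(** With [y = A^(k./2) e]: for [k] odd, [w k = y^T A y] is even as [A] is symmetric with zero
    diagonal; for [k] even, [w k = y^T y] is congruent to [e^T y = w k./2], and induction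
    applies. *)
Lemma walks_even k : (0 < k)%N -> (2 %| w k)%Z.
Proof.
elim/ltn_ind: k => k IHk k0; have defk := odd_double_half k; case: (odd k) defk => defk.
  have -> : w k = \sum_i \sum_j (A ^+ k./2 *m e) i 0 * A i j * (A ^+ k./2 *m e) j 0.
    rewrite -{1}defk add1n -addnn -addSn addnC -walksE exprS -mulmxE -mulmxA mxE.
    apply: eq_bigr => i _; rewrite mxE [X in _ * X]mxE big_distrr /=.
    by apply: eq_bigr => j _; rewrite mulrA.
  set y := A ^+ k./2 *m e; have := @dvdz2_sum_sym _ (fun i j => y i 0 * A i j * y j 0).
  rewrite [X in _ - X]big1 ?subr0 => [|i _]; last by rewrite Adiag mulr0 mul0r.
  apply=> i j; have -> : A i j = A j i by rewrite -{1}Asym mxE.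
  by rewrite mulrC mulrA mulrAC.
have sqrE (y : 'cV[int]_N) :
    (y^T *m y) 0 0 = ((const_mx 1 : 'rV_N) *m y) 0 0 + \sum_i y i 0 * (y i 0 - 1).
  rewrite mxE [X in X + _]mxE -big_split; apply: eq_bigr => i _ /=.
  by rewrite mxE [const_mx _ _ _]mxE; ring.
have -> : w k = w k./2 + \sum_i (A ^+ k./2 *m e) i 0 * ((A ^+ k./2 *m e) i 0 - 1).
  by rewrite -{1}defk add0n -addnn -walksE sqrE mulmxA.
rewrite rpredD ?IHk //; [by lia | by lia | apply: rpred_sum => i _].
exact: dvdz2_mul_pred.
Qed.

Let W : 'M[int]_N := \matrix_(i, j) (A ^+ j *m e) i 0.
(** A divisor of row [i] of the Gram matrix [W^T W]: all its entries are even except possibly the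
    corner [w 0 = N]. *)
Let D (i : 'I_N) : int := if (i == 0) && odd N then 1 else 2.
Let G : 'M[int]_N := \matrix_(i, j) (w (i + j) %/ D i)%Z.

Lemma walks0 : w 0 = N%:Z.
Proof.
rewrite /walks expr0 mulmx1 mxE (eq_bigr (fun=> 1)) => [|i _]; last by rewrite !mxE.
by rewrite sumr_const card_ord natz.
Qed.

Lemma walk_gram i j : (W^T *m W) i j = w (i + j).
Proof. by rewrite -walksE !mxE; apply: eq_bigr => k _; rewrite !mxE. Qed.

Lemma walk_gramE : W^T *m W = diag_mx (\row_i D i) *m G.
Proof.
rewrite mul_diag_mx; apply/matrixP=> i j; rewrite walk_gram !mxE.
rewrite mulrC divzK // /D; case: ifP => [_|]; first exact: dvd1z.
have [->|i0] := eqVneq i 0; last by rewrite walks_even // addn_gt0 lt0n i0.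
case: (posnP j) => [->|j0 _]; last by rewrite walks_even ?addn_gt0 ?j0 ?orbT.
by rewrite walks0 andTb dvdz2_nat => ->.
Qed.

Lemma prod_D : \prod_i D i = (2 ^+ N./2) ^+ 2.
Proof.
rewrite (bigD1 ord0) //= (eq_bigr (fun=> 2)) => [|i i0]; last by rewrite /D (negPf i0).
rewrite prodr_const cardC1 card_ord /= /D eqxx andTb -exprM muln2.
case: ifP => oN; first by rewrite mul1r; congr (_ ^+ _); have := odd_double_half N; rewrite oN; lia.
by rewrite -exprS; congr (_ ^+ _); have := odd_double_half N; rewrite oN; lia.
Qed.

Lemma det_walk_sqr : (\det W) ^+ 2 = (2 ^+ N./2) ^+ 2 * \det G.
Proof.
rewrite -prod_D expr2 -{1}det_tr -det_mulmx walk_gramE det_mulmx det_diag.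
by congr (_ * _); apply: eq_bigr => i _; rewrite mxE.
Qed.

Lemma dvdz_det_walk : (2 ^+ N./2 %| \det W)%Z.
Proof. by rewrite -(@dvdz_pexp2r _ _ 2) // det_walk_sqr dvdz_mulr. Qed.

Local Notation A2 := (redmx 2 A).
Local Notation e2 := (const_mx 1 : 'cV['F_2]_N).

Lemma red_walk k : A2 ^+ k *m e2 = redmx 2 (A ^+ k *m e).
Proof. by rewrite map_mxM map_const_mx rmorphXn. Qed.

Lemma red_walksE i j : ((A2 ^+ i *m e2)^T *m (A2 ^+ j *m e2)) 0 0 = (w (i + j))%:~R.
Proof. by rewrite !red_walk map_trmx -map_mxM [LHS]mxE walksE. Qed.

Lemma walk_mul_horner (a : 'cV['F_2]_N) :
  redmx 2 W *m a = horner_mx A2 (rVpoly a^T) *m e2.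
Proof.
have sr : (size (rVpoly a^T) <= N)%N by apply: size_poly.
rewrite (horner_mx_sum _ sr) mulmx_suml; apply/matrixP=> i j.
rewrite ord1 summxE mxE; apply: eq_bigr => k _.
rewrite coef_rVpoly_ord -scalemxAl [RHS]mxE [a^T _ _]mxE mulrC; congr (_ * _).
by rewrite red_walk mxE mxE [RHS]mxE.
Qed.

(* The vectors [A^k e] with [s <= k <= s + N./2] are mutually orthogonal over
   'F_2, so they span a totally isotropic subspace and are dependent. *)
Lemma walk_annihilator : exists2 c : {poly 'F_2}, c != 0 &
  (size c <= (uphalf N).+1)%N /\ horner_mx A2 c *m e2 = 0.
Proof.
(* Since [w 0 = N], the vector [e] is isotropic only for [N] even; for [N] odd the exponents start
   at 1. *)
pose s := odd N : nat; pose K := N./2.+1.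
pose X : 'M['F_2]_(K, N) := \matrix_(i, j) (A2 ^+ (s + i) *m e2) j 0.
have XX : X *m X^T = 0.
  apply/matrixP=> i j; rewrite [RHS]mxE.
  have -> : (X *m X^T) i j = (w ((s + i) + (s + j)))%:~R.
    by rewrite -red_walksE !mxE; apply: eq_bigr => k _; rewrite !mxE.
  apply/(@intr_FpP 2) => //; have [ij0|] := posnP (s + i + (s + j)); last exact: walks_even.
  rewrite ij0 walks0 dvdz2_nat.
  by move: ij0; rewrite /s; case: (odd N).
have : ~~ row_free X.
  (* Isotropy bounds twice the rank by [N], while [2 K > N]. *)
  apply/negP => /eqP rkX; have := mulmx0_rank_max XX.
  by rewrite mxrank_tr rkX /K; have := odd_double_half N; lia.
rewrite -kermx_eq0 => /rowV0Pn [v /sub_kermxP vX v0].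
exists ('X^s * rVpoly v).
  apply: mulf_neq0; first by rewrite monic_neq0 ?monicXn.
  by apply: contraNneq v0 => Ev; rewrite -[v]rVpolyK Ev linear0.
split.
  have := size_poly K (fun k => if insub k is Some i then v 0 i else 0).
  rewrite -/(rVpoly v) => sv; apply: leq_trans (size_polyMleq _ _) _.
  rewrite size_polyXn addSn -pred_Sn; apply: leq_trans (leq_add (leqnn _) sv) _.
  by rewrite /K /s addnS -uphalf_half.
have sv : (size (rVpoly v) <= K)%N by apply: size_poly.
rewrite rmorphM rmorphXn /= horner_mx_X (horner_mx_sum _ sv) mulr_sumr mulmx_suml.
apply/trmx_inj; rewrite trmx0 -vX; apply/matrixP=> i j.
rewrite [LHS]mxE summxE [RHS]mxE; apply: eq_bigr => k _.
by rewrite coef_rVpoly_ord ord1 [X k j]mxE exprD -scalerAr -scalemxAl [LHS]mxE.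
Qed.

Lemma dvdz_D i : (D i %| 2)%Z.
Proof. by rewrite /D; case: ifP. Qed.

(* The Gram matrix [W^T W = D G] with [det G] odd gives
   [W^-1 = G^-1 D^-1 W^T] over the integers localized at 2. *)
Lemma red_walk_solve (u : 'cV[int]_N) : ~~ (2 %| \det G)%Z ->
    (forall k, (2 %| (((A ^+ k *m e)^T *m u) 0 0)%R)%Z) ->
  exists a, redmx 2 u = redmx 2 W *m a.
Proof.
move=> oG eAu; pose y : 'cV[int]_N := \col_i (((W^T *m u) i 0)%R %/ D i)%Z.
have Dy : W^T *m u = diag_mx (\row_i D i) *m y.
  rewrite mul_diag_mx; apply/matrixP=> i j; rewrite ord1 [RHS]mxE [y _ _]mxE.
  rewrite [_ 0 i]mxE mulrC divzK //; apply: dvdz_trans (dvdz_D i) _.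
  suff -> : (W^T *m u) i 0 = ((A ^+ i *m e)^T *m u) 0 0 by [].
  by rewrite !mxE; apply: eq_bigr => k _; rewrite !mxE.
have W0 : \det W != 0.
  apply: contraNneq oG => W0; have /eqP := det_walk_sqr; rewrite W0 expr0n eq_sym mulf_eq0.
  by rewrite expf_eq0 expf_eq0 /= andbF => /eqP->.
have Wu : \det G *: u = W *m (\adj G *m y).
  have : W^T *m (\det G *: u - W *m (\adj G *m y)) = 0.
    rewrite mulmxBr -scalemxAr Dy mulmxA walk_gramE -!mulmxA (mulmxA G) mul_mx_adj.
    by rewrite mul_scalar_mx -scalemxAr subrr.
  move/(congr1 (mulmx (\adj W^T))); rewrite mulmxA mul_adj_mx mul_scalar_mx mulmx0.
  rewrite det_tr => /matrixP H; apply/eqP; rewrite -subr_eq0; apply/eqP/matrixP=> i j.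
  have /eqP := H i j; rewrite mxE [in X in _ == X]mxE mulf_eq0 (negPf W0) => /eqP ->.
  by rewrite mxE.
exists (redmx 2 (\adj G *m y)); rewrite -map_mxM -Wu map_mxZ /=.
suff -> : (\det G)%:~R = 1 :> 'F_2 by rewrite scale1r.
by case/orP: (F2_cases (\det G)%:~R); rewrite ?intr_Fp_eq0 ?(negPf oG) // => /eqP.
Qed.

(** [red_walk_solve] gives [u] as a polynomial in [A] applied to [e], and reduction modulo the
    annihilator shortens it. For [N] odd, [e^T u] is congruent to [a 0], since only [w 0 = N] is
    odd. *)
Lemma red_walk_short (u : 'cV[int]_N) : ~~ (2 %| \det G)%Z ->
    (forall k, (2 %| (((A ^+ k *m e)^T *m u) 0 0)%R)%Z) ->
  exists a : nat -> int, [/\ (odd N -> a 0%N = 0) &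
    redmx 2 u = redmx 2 (\sum_(i < uphalf N) a i *: (A ^+ i *m e))].
Proof.
move=> oG eAu; have [a0 ua0] := red_walk_solve oG eAu.
have [c c0 [sc ce]] := walk_annihilator.
pose q := rVpoly a0^T %% c.
have sq : (size q <= uphalf N)%N by rewrite -ltnS (leq_trans _ sc) // ltn_modp.
have uq : redmx 2 u = horner_mx A2 q *m e2.
  rewrite ua0 walk_mul_horner {1}(divp_eq (rVpoly a0^T) c) rmorphD rmorphM /=.
  by rewrite mulmxDl -mulmxE -mulmxA ce mulmx0 add0r.
rewrite (horner_mx_sum _ sq) mulmx_suml in uq.
exists (fun i => Posz (q`_i)%R); split.
  move=> oN; have /(@intr_FpP 2 isT) := eAu 0%N.
  have -> : (((A ^+ 0 *m e)^T *m u) 0 0)%:~R = ((A2 ^+ 0 *m e2)^T *m redmx 2 u) 0 0.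
    by rewrite red_walk map_trmx -map_mxM [RHS]mxE.
  rewrite uq mulmx_sumr summxE (bigD1 ord0) //= big1 => [|i i0].
    rewrite -scalemxAl -scalemxAr mxE red_walksE walks0 addr0.
    move/eqP; rewrite mulf_eq0 intr_Fp_eq0 // dvdz2_nat oN orbF.
    by move/eqP->.
  rewrite -scalemxAl -scalemxAr mxE red_walksE.
  have /(@intr_FpP 2 isT) -> : (2 %| w (0 + i))%Z by rewrite walks_even // lt0n.
  by rewrite mulr0.
rewrite uq raddf_sum; apply: eq_bigr => i _ /=; rewrite map_mxZ -red_walk scalemxAl.
by congr (_ *: _ *m _); exact: esym (natr_Zp _).
Qed.

(* Modulo 4 the off-diagonal terms of [x^T A^k x] cancel in pairs, since all the
   walk counts involved are even. *)
Lemma dvdz4_sum_walks (a : nat -> int) r k : (odd N -> a 0%N = 0) ->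
    (4 %| (\sum_(i < r) \sum_(j < r) a i * a j * w (i + j + k))%R)%Z ->
  (4 %| (\sum_(i < r) a i ^+ 2 * w (i.*2 + k))%R)%Z.
Proof.
move=> a0; have even_f (i j : nat) : (2 %| a i * a j * w (i + j + k))%Z.
  (* Only [w 0 = N] can be odd, and then its coefficient [a 0 ^ 2] is zero. *)
  have [ijk|ijk] := posnP (i + j + k); last by rewrite dvdz_mull ?walks_even.
  have [-> -> ->] : [/\ i = 0, j = 0 & k = 0]%N by split; lia.
  case oN : (odd N); first by rewrite (a0 oN) !mul0r dvdz0.
  by rewrite walks0 dvdz_mull // dvdz2_nat oN.
pose f (i j : 'I_r) := ((a i * a j * w (i + j + k))%R %/ 2)%Z.
have fE (i j : 'I_r) : a i * a j * w (i + j + k) = 2 * f i j.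
  by rewrite [RHS]mulrC divzK.
have -> : \sum_(i < r) a i ^+ 2 * w (i.*2 + k) = 2 * \sum_i f i i.
  by rewrite mulr_sumr; apply: eq_bigr => i _; rewrite -fE -expr2 addnn.
have -> : \sum_(i < r) \sum_(j < r) a i * a j * w (i + j + k) = 2 * \sum_i \sum_j f i j.
  rewrite mulr_sumr; apply: eq_bigr => i _; rewrite mulr_sumr.
  by apply: eq_bigr => j _; rewrite -fE.
rewrite !dvdz4_double => S4.
have fsym i j : f i j = f j i by rewrite /f (mulrC (a i)) (addnC i).
have := dvdz2_sum_sym fsym; set s := \sum_i f i i; set t := \sum_i _ in S4 *.
by move=> st; rewrite -[s](subKr t) rpredB.
Qed.

(** If the quotient [d] is odd, so is [\det G = d ^ 2], and [u] is congruent modulo 2 to a short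
    combination [x] of the [A^i e]. Modulo 4, [x^T A^k x] vanishes and is congruent to the sum of
    the [a_i ^ 2 w (2 i + k)]. So [G b] is even for [b] carrying [a_i ^ 2] at index [2 i]; hence
    [b], all [a_i] and [u] vanish modulo 2. *)
Lemma dvdz2_det_walk (u : 'cV[int]_N) : redmx 2 u != 0 ->
    (forall k, (2 %| (((A ^+ k *m e)^T *m u) 0 0)%R)%Z) ->
    (forall k, (4 %| ((u^T *m A ^+ k *m u) 0 0)%R)%Z) ->
  (2 %| (\det W)%R %/ (2 ^+ N./2)%R)%Z.
Proof.
move=> u0 eAu uAu; have Wsqr := det_walk_sqr; set h := N./2 in Wsqr *.
have /dvdzP [d defW] := dvdz_det_walk; rewrite -/h in defW.
have h0 : 2 ^+ h != 0 :> int by rewrite expf_eq0 andbF.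
rewrite defW mulzK //; rewrite defW exprMn mulrC in Wsqr.
have dG : d ^+ 2 = \det G by apply: (mulfI _ Wsqr); rewrite expf_eq0.
apply/negPn/negP => od; have oG : ~~ (2 %| \det G)%Z.
  apply: contra od => /(@intr_FpP 2 isT); rewrite -dG rmorphXn /= => /eqP.
  by rewrite expf_eq0 /= intr_Fp_eq0.
have [a [a0 ua]] := red_walk_short oG eAu.
pose x := \sum_(i < uphalf N) a i *: (A ^+ i *m e); rewrite -/x in ua.
have [v uxv] : exists v, u - x = 2 *: v.
  by apply: redmx0_quot => //; rewrite map_mxB ua subrr.
have xAx k : (x^T *m A ^+ k *m x) 0 0
    = \sum_(i < uphalf N) \sum_(j < uphalf N) a i * a j * w (i + j + k).
  have -> : x^T = \sum_(i < uphalf N) a i *: (A ^+ i *m e)^T.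
    by rewrite /x raddf_sum; apply: eq_bigr => i _ /=; rewrite linearZ.
  rewrite !mulmx_suml summxE; apply: eq_bigr => i _.
  rewrite /x mulmx_sumr summxE; apply: eq_bigr => j _.
  rewrite -!scalemxAl -scalemxAr scalerA mxE; congr (_ * _).
  rewrite -mulmxA [A ^+ k *m _]mulmxA -[A ^+ k *m A ^+ j]/(A ^+ k * A ^+ j) -exprD walksE.
  by rewrite addnCA addnC.
(* With [x = u - 2 v], the two cross terms are equal by symmetry and add up to a multiple of 4. *)
have xA4 k : (4 %| ((x^T *m A ^+ k *m x) 0 0)%R)%Z.
  have -> : x = u - 2 *: v by rewrite -uxv opprB addrC subrK.
  have vu : (v^T *m A ^+ k *m u) 0 0 = (u^T *m A ^+ k *m v) 0 0.
    have -> : u^T *m A ^+ k *m v = (v^T *m A ^+ k *m u)^T.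
      by rewrite !trmx_mul trmxK trmx_expr mulmxA.
    by rewrite [RHS]mxE.
  have -> : ((u - 2 *: v)^T *m A ^+ k *m (u - 2 *: v)) 0 0 = (u^T *m A ^+ k *m u) 0 0
     - 4 * (u^T *m A ^+ k *m v) 0 0 + 4 * (v^T *m A ^+ k *m v) 0 0.
    rewrite [(u - _)^T]linearB /= [(2 *: v)^T]linearZ /= !mulmxBl !mulmxBr.
    rewrite -!scalemxAl -!scalemxAr; move: vu.
    move: (u^T *m _ *m u) (v^T *m _ *m u) (u^T *m _ *m v) (v^T *m _ *m v).
    by move=> p q r s qr; rewrite !mxE qr; ring.
  by rewrite rpredD ?rpredB ?uAu // dvdz_mulr.
pose b : 'cV[int]_N := \col_j (if odd j then 0 else a j./2 ^+ 2).
have Gb k : (2 %| ((G *m b) k 0)%R)%Z.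
  have : (4 %| ((W^T *m W *m b) k 0)%R)%Z.
    have -> : (W^T *m W *m b) k 0 = \sum_(i < uphalf N) a i ^+ 2 * w (i.*2 + k).
      rewrite -(sum_even_index N (fun i => a i ^+ 2 * w (i.*2 + k))) mxE; apply: eq_bigr => j _.
      rewrite walk_gram [b _ _]mxE; case: ifPn => oj; first by rewrite mulr0.
      by rewrite mulrC (even_halfK oj) addnC.
    by apply: dvdz4_sum_walks => //; rewrite -xAx.
  rewrite walk_gramE -mulmxA mul_diag_mx mxE [(\row__ _) 0 k]mxE /D.
  case: ifP => _; first by rewrite mul1r; apply: dvdz_trans.
  by rewrite dvdz4_double.
have b0 : redmx 2 b = 0.
  have /eqP Gb0 : redmx 2 (G *m b) == 0.
    by apply/(@redmx_eq0P 2) => // i j; rewrite ord1.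
  have Gu : redmx 2 G \in unitmx by rewrite unitmxE det_map_mx unitfE /= intr_Fp_eq0.
  by rewrite -[LHS](mulKmx Gu) -map_mxM Gb0 mulmx0.
case/negP: u0; rewrite ua /x raddf_sum big1 // => i _ /=.
(* The shortness of the combination makes every [2 i] an index of [b]. *)
have iN : (i.*2 < N)%N by have := ltn_ord i; lia.
have /eqP : (redmx 2 b) (Ordinal iN) 0 = 0 by rewrite b0 mxE.
rewrite !mxE /= odd_double doubleK rmorphXn expf_eq0 /= => /eqP ai0.
by rewrite map_mxZ /= ai0 scale0r.
Qed.

End WalkMatrix.

(** * Krylov relations *)

(* The matrix of multiplication by the variable modulo [q], for [q] monic of
   degree [n.+1], in the basis of the powers of the variable. *)
Definition mulX_mx (R : nzRingType) n (q : {poly R}) : 'M[R]_n.+1 :=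
  \matrix_(i, j) if (j < n)%N then (i == j.+1 :> nat)%:R else - q`_i.

Lemma map_mulX_mx (R S : nzRingType) (f : {rmorphism R -> S}) n q :
  map_mx f (mulX_mx n q) = mulX_mx n (map_poly f q).
Proof.
apply/matrixP=> i j; rewrite !mxE; case: ifP => _; first by rewrite rmorph_nat.
by rewrite rmorphN coef_map.
Qed.

(** Row [i] of the eigenvector equation reads [d_(i-1) - q_i d_n = mu d_i], so by descent from [n]
    the last coordinate determines the eigenvector. *)
Lemma mulX_mx_eigenline (F : fieldType) n (q : {poly F}) mu (a b : 'cV_n.+1) :
    mulX_mx n q *m a = mu *: a -> mulX_mx n q *m b = mu *: b -> a != 0 ->
  exists c, b = c *: a.
Proof.
have top0 (d : 'cV_n.+1) : mulX_mx n q *m d = mu *: d -> d ord_max 0 = 0 -> d = 0.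
  move=> Cd dn; have rec k : (k <= n)%N -> d (inord (n - k)) 0 = 0.
    elim: k => [|k IHk] kn.
      by rewrite subn0 -dn; congr (d _ 0); apply/val_inj; rewrite /= inordK.
    have e1 : (inord (n - k) : 'I_n.+1) = (n - k)%N :> nat by rewrite inordK //; lia.
    have e2 : (inord (n - k.+1) : 'I_n.+1) = (n - k.+1)%N :> nat by rewrite inordK //; lia.
    have /matrixP /(_ (inord (n - k)) 0) := Cd; rewrite mxE [RHS]mxE IHk 1?ltnW // mulr0.
    rewrite (bigD1 (inord (n - k.+1))) //= big1 => [|j jk].
      rewrite mxE e1 e2 ifT; last by lia.
      have -> : (n - k == (n - k.+1).+1)%N by lia.
      by rewrite mulr1n mul1r addr0.
    rewrite mxE e1; case: ltnP => jn; last first.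
      have -> : j = ord_max by apply/val_inj => /=; have := ltn_ord j; lia.
      by rewrite dn mulr0.
    case: eqP => [nk|]; rewrite ?mul0r //; case/negP: jk; apply/eqP/val_inj => /=.
    by rewrite e2; lia.
  apply/matrixP=> i j; rewrite ord1 mxE -(rec (n - i)%N) ?leq_subr //.
  by congr (d _ 0); apply/val_inj; rewrite /= inordK ?subKn // -ltnS.
move=> Ca Cb a0; have an : a ord_max 0 != 0 by apply: contraNneq a0 => /(top0 _ Ca)->.
exists (b ord_max 0 / a ord_max 0); apply/eqP; rewrite -subr_eq0; apply/eqP/top0.
  by rewrite mulmxBr -scalemxAr Ca Cb scalerBr !scalerA mulrC.
by rewrite !mxE divfK // subrr.
Qed.

Lemma mulmx_det_neq0I (R : idomainType) m n (W : 'M[R]_n) (X Y : 'M_(m, n)) :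
  \det W != 0 -> X *m W = Y *m W -> X = Y.
Proof.
move=> W0 /(congr1 (mulmx^~ (\adj W))) /=; rewrite -!mulmxA mul_mx_adj.
rewrite !mul_mx_scalar => /matrixP H; apply/matrixP=> i j.
by have := H i j; rewrite !mxE; apply: mulfI.
Qed.

Lemma det_neq0_gram (R : idomainType) n (X Y : 'M[R]_n) :
  X^T *m X = Y^T *m Y -> \det X != 0 -> \det Y != 0.
Proof.
move/(congr1 determinant); rewrite !det_mulmx !det_tr => XY.
by apply: contraNneq => Y0; move/eqP: XY; rewrite Y0 mul0r mulf_eq0 orbb.
Qed.

(** [A] shifts the columns [A^j e], and Cayley-Hamilton rewrites the image of the last one. *)
Lemma walk_mx_mulX n (G : sgraph n.+1) (A := adj_mx int G) :
  A *m walk_mx G = walk_mx G *m mulX_mx n (char_poly A).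
Proof.
have AW i j : (A *m walk_mx G) i j = (A ^+ j.+1 *m (const_mx 1 : 'cV_n.+1)) i 0.
  rewrite exprS -mulmxE -mulmxA mxE [RHS]mxE; apply: eq_bigr => k _.
  by rewrite [walk_mx _ _ _]mxE.
apply/matrixP=> i j; rewrite AW [RHS]mxE; have [jn|nj] := ltnP j n.
  rewrite (bigD1 (Ordinal (jn : (j.+1 < n.+1)%N))) //= big1 => [|k kj].
    by rewrite addr0 [mulX_mx _ _ _ _]mxE jn eqxx mulr1 [walk_mx _ _ _]mxE.
  by rewrite [mulX_mx _ _ _ _]mxE jn; move: kj; rewrite -val_eqE /= => /negPf ->; rewrite mulr0.
have -> : j = n :> nat by apply/eqP; rewrite eqn_leq nj -ltnS ltn_ord.
have := Cayley_Hamilton A; rewrite (@horner_mx_sum _ _ _ _ n.+2) ?size_char_poly //.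
rewrite big_ord_recr /=; have := char_poly_monic A.
rewrite monicE lead_coefE size_char_poly /= => /eqP -> /eqP.
rewrite scale1r addrC addr_eq0 => /eqP ->.
rewrite mulNmx mulmx_suml mxE summxE -sumrN; apply: eq_bigr => k _.
rewrite [mulX_mx _ _ _ _]mxE ltnNge nj /= -scalemxAl mxE mulrN [walk_mx _ _ _]mxE.
by rewrite mulrC.
Qed.

(** * The level of the rational orthogonal matrix *)

Lemma adj_mx_compl (R : nzRingType) n (G : sgraph n) :
  adj_mx R (compl_graph G) = const_mx 1 - 1%:M - adj_mx R G.
Proof.
apply/matrixP=> i j; rewrite !mxE /= /compl_adj /=; have [->|_] := eqVneq i j.
  by rewrite adj_irrefl mulr1n subrr subr0.
by case: (G i j); rewrite /= mulr0n subr0 ?mulr1n ?mulr0n ?subrr ?subr0.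
Qed.

Lemma char_poly_eq_spectrum n (G H : sgraph n) :
  perm_eq (spectrum G) (spectrum H) ->
  char_poly (adj_mx int G) = char_poly (adj_mx int H).
Proof.
move=> GH; apply: (map_inj_poly (f := intr : int -> algC)); [exact: intr_inj | by [] |].
rewrite !(map_char_poly (intr : {rmorphism int -> algC})) !map_adj_mx.
by rewrite !char_poly_spectrum; apply: perm_big.
Qed.

(** By [char_poly_compl] the complement's spectrum determines [char_poly + walk_num], so both
    spectra together determine [walk_num]. *)
Lemma same_gen_spectrum_walks n (G H : sgraph n.+1) k :
  same_gen_spectrum G H -> walks (adj_mx int G) k = walks (adj_mx int H) k.
Proof.
case=> /char_poly_eq_spectrum chGH /char_poly_eq_spectrum chGHc.
apply: eq_walks; first exact: chGH.
move: chGHc; rewrite !adj_mx_compl => /(congr1 (comp_poly (- 'X - 1))).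
rewrite !char_poly_compl => /(mulfI _); rewrite expf_eq0 oppr_eq0 oner_eq0 andbF.
by move=> /(_ isT); rewrite chGH => /addrI.
Qed.

Lemma same_gen_spectrum_gram n (G H : sgraph n.+1) : same_gen_spectrum G H ->
  (walk_mx G)^T *m walk_mx G = (walk_mx H)^T *m walk_mx H.
Proof.
move=> GH; apply/matrixP=> i j; have WG K := walk_gram (trmx_adj_mx int K) i j.
by rewrite [LHS]WG [RHS]WG; exact: same_gen_spectrum_walks.
Qed.

Lemma dvdz_walk_det_odd_prime p n (G : sgraph n.+1) : prime p -> odd p ->
  (p%:Z ^+ 2 %| \det (walk_mx G))%Z ->
  (p%:Z ^+ 2 %| (\det (walk_mx G))%R %/ (2 ^+ n.+1./2)%R)%Z.
Proof.
move=> p_pr op; set d := \det _ => pd.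
have /dvdzP [q dq] : (2 ^+ n.+1./2 %| d)%Z.
  by apply: dvdz_det_walk; [exact: trmx_adj_mx | exact: adj_mx_diag].
rewrite dq mulzK ?expf_eq0 ?andbF //; move: pd; rewrite dq Gauss_dvdzl //.
by rewrite coprimezXl // coprimezXr // coprimezE /= coprimen2.
Qed.

Section Level.
Variables (n : nat) (A B C W1 W2 : 'M[int]_n.+1).
Hypotheses (W20 : \det W2 != 0) (gram : W1^T *m W1 = W2^T *m W2).
Hypotheses (AW : A *m W1 = W1 *m C) (BW : B *m W2 = W2 *m C).
Hypotheses (Asym : A^T = A) (Bsym : B^T = B).
Hypotheses (W1ones : forall i, W1 i 0 = 1) (W2ones : forall i, W2 i 0 = 1).
Notation e := (const_mx 1 : 'cV[int]_n.+1).

Section Scaled.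
Variables (l : int) (U : 'M[int]_n.+1).
Hypotheses (l0 : l != 0) (UW : U *m W2 = l *: W1).

(** Between [W2^T] and [W2], both sides become [l ^ 2] times the common Gram matrix. *)
Lemma mate_gram : U^T *m U = (l ^+ 2)%:M.
Proof.
apply: (mulmx_det_neq0I W20); apply/trmx_inj.
apply: (mulmx_det_neq0I W20).
have -> : (U^T *m U *m W2)^T *m W2 = (U *m W2)^T *m (U *m W2).
  by rewrite !trmx_mul trmxK !mulmxA.
rewrite UW mul_scalar_mx [(l *: W1)^T]linearZ [(_ *: W2)^T]linearZ /=.
by rewrite -!scalemxAl -scalemxAr scalerA gram -expr2.
Qed.

Lemma mate_trmx : U^T *m W1 = l *: W2.
Proof.
have : l *: (U^T *m W1) = l *: (l *: W2).
  by rewrite scalemxAr -UW mulmxA mate_gram mul_scalar_mx scalerA.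
by move/matrixP => E; apply/matrixP=> i j; have := E i j; rewrite !mxE; apply: mulfI.
Qed.

Lemma mate_comm : A *m U = U *m B.
Proof.
apply: (mulmx_det_neq0I W20).
by rewrite -!mulmxA UW BW mulmxA UW -scalemxAr -scalemxAl AW.
Qed.

Lemma mate_pow k : U^T *m A ^+ k = B ^+ k *m U^T.
Proof.
elim: k => [|k IHk]; first by rewrite !expr0 mulmx1 mul1mx.
have UA : U^T *m A = B *m U^T.
  by rewrite -{1}Asym -trmx_mul mate_comm trmx_mul Bsym.
by rewrite !exprS -!mulmxE mulmxA UA -mulmxA IHk mulmxA.
Qed.

(** The first columns of [W1] and [W2] are [e], so this is the first column of [mate_trmx]. *)
Lemma mate_ones : U^T *m e = const_mx l.
Proof.
apply/matrixP=> i j; rewrite ord1 [RHS]mxE.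
transitivity (l * W2 i 0); last by rewrite W2ones mulr1.
have /matrixP /(_ i 0) := mate_trmx; rewrite [RHS]mxE => <-.
rewrite mxE [RHS]mxE; apply: eq_bigr => s _.
by rewrite W1ones [const_mx _ _ _]mxE.
Qed.

Lemma mate_walk k : U^T *m (A ^+ k *m e) = l *: (B ^+ k *m e).
Proof.
rewrite mulmxA mate_pow -mulmxA mate_ones scalemxAr; congr (_ *m _).
by apply/matrixP=> i j; rewrite !mxE mulr1.
Qed.

Lemma mate_quadratic k j : ((col j U)^T *m A ^+ k *m col j U) 0 0 = l ^+ 2 * (B ^+ k) j j.
Proof.
have /matrixP /(_ j j) : U^T *m A ^+ k *m U = l ^+ 2 *: B ^+ k.
  by rewrite mate_pow -mulmxA mate_gram mul_mx_scalar.
rewrite [RHS]mxE => <-.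
by rewrite tr_col -row_mul !mxE; apply: eq_bigr => s _; rewrite !mxE.
Qed.

End Scaled.

(** Descent on [l] from the Cramer solution: a prime divisor of [l] divides all of [U] and can be
    cancelled, until [l = 1]. *)
Lemma level_one :
    (forall p l U, prime p -> (p%:Z %| l)%Z -> l != 0 -> U *m W2 = l *: W1 ->
       redmx p U = 0) ->
  exists U : 'M[int]_n.+1, U *m W2 = W1.
Proof.
move=> red0; suff: forall l : nat, (0 < l)%N -> forall U, U *m W2 = l%:Z *: W1 ->
    exists U : 'M[int]_n.+1, U *m W2 = W1.
  move/(_ `|\det W2|%N); rewrite absz_gt0.
  (* The sign makes the scalar [|\det W2|], a natural number. *)
  move/(_ W20 (sgz (\det W2) *: (W1 *m \adj W2))); apply.
  by rewrite -scalemxAl -mulmxA mul_adj_mx mul_mx_scalar scalerA -abszEsg.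
elim/ltn_ind => l IHl l0 U UW.
have [l1|l1] := eqVneq l 1%N; first by exists U; rewrite UW l1 scale1r.
have p_pr : prime (pdiv l) by rewrite pdiv_prime; lia.
have pl := pdiv_dvd l; set p := pdiv l in p_pr pl.
have l0' : l%:Z != 0 by lia.
have /(redmx0_quot p_pr) [V UV] := red0 p l%:Z U p_pr pl l0' UW.
have [k lk] := dvdnP pl.
have k0 : (0 < k)%N by rewrite lt0n; apply: contraTneq l0 => k0; rewrite lk k0.
apply: (IHl k _ k0 V).
  by rewrite lk -[X in (X < _)%N]muln1 ltn_pmul2l ?prime_gt1.
move: UW; rewrite UV lk -scalemxAl => /matrixP E; apply/matrixP=> i j.
have p0 : p%:Z != 0 by have := prime_gt0 p_pr; lia.
apply: (mulfI p0); have := E i j; rewrite mxE => ->.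
by rewrite mxE [in RHS]mxE PoszM mulrA [p%:Z * _]mulrC.
Qed.

End Level.

(** * Integral orthogonal matrices and isomorphism *)

(** In each column the entries and their squares both sum to 1, so the nonnegative integers
    [x * (x - 1)] sum to 0 and every entry is 0 or 1. Each column has a single 1, and orthogonality
    puts these in distinct rows: [U] is a permutation matrix. *)
Lemma isomorphic_of_orthogonal n (G H : sgraph n) (U : 'M[int]_n) :
    U^T *m U = 1%:M -> U^T *m const_mx 1 = const_mx 1 :> 'cV_n ->
    adj_mx int G *m U = U *m adj_mx int H ->
  isomorphic H G.
Proof.
move=> UU U1 AU.
have sum1 j : \sum_i U i j = 1.
  have /matrixP /(_ j 0) := U1; rewrite !mxE => <-.
  by apply: eq_bigr => i _; rewrite !mxE mulr1.
have U01 i j : (U i j == 0) || (U i j == 1).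
  have : \sum_i U i j * (U i j - 1) = 0.
    have /matrixP /(_ j j) := UU; rewrite !mxE eqxx => s2.
    have := sum1 j; rewrite -[RHS]s2 => /esym/eqP; rewrite -subr_eq0 -sumrB => /eqP s0.
    by rewrite -[RHS]s0; apply: eq_bigr => k _; rewrite !mxE; ring.
  move/eqP; rewrite psumr_eq0 => [/allP /(_ i (mem_index_enum i)) /=|k _].
    by rewrite mulf_eq0 subr_eq0.
  by set x := U k j; nia.
have ex j : exists i, U i j == 1.
  apply/existsP; apply: contraT; rewrite negb_exists => /forallP U0.
  have := sum1 j; rewrite big1 // => i _.
  by have /orP[/eqP //|U1ij] := U01 i j; move: (U0 i); rewrite U1ij.
pose f j := xchoose (ex j).
have Ufj j : U (f j) j = 1 by apply/eqP/(xchooseP (ex j)).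
have Uf i j : U i j = (i == f j)%:R.
  have [->|ij] := eqVneq; first exact: Ufj.
  have U0 k : 0 <= U k j by case/orP: (U01 k j) => /eqP->.
  apply/eqP; have := sum1 j; rewrite (bigD1 (f j)) //= Ufj -[RHS]addr0 => /addrI/eqP.
  rewrite psumr_eq0 => [/allP /(_ i (mem_index_enum i))|k _] //.
  by rewrite ij.
have finj : injective f.
  move=> j k fjk; have /matrixP /(_ j k) := UU; rewrite !mxE.
  rewrite (bigD1 (f j)) //= big1 => [|i ij]; last by rewrite mxE Uf (negPf ij) mul0r.
  by rewrite mxE {2}fjk !Ufj; case: eqVneq.
exists f; first exact: injF_bij.
move=> j k; have /matrixP /(_ (f j) k) := AU; rewrite !mxE.
rewrite (bigD1 (f k)) //= big1 => [|i ik]; last by rewrite Uf (negPf ik) mulr0.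
rewrite [in RHS](bigD1 j) //= big1 => [|i ij]; last first.
  by rewrite Uf (inj_eq finj) eq_sym (negPf ij) mul0r.
rewrite !mxE !Ufj mulr1 mul1r !addr0.
by case: (G _ _); case: (H _ _).
Qed.

(** * Graphs with the same generalized spectrum *)

Section Mates.
Variables (n : nat) (G H : sgraph n.+1).
Hypotheses (Gctrl : controllable G) (HG : same_gen_spectrum H G).
Local Notation A := (adj_mx int G).
Local Notation B := (adj_mx int H).
Local Notation W1 := (walk_mx G).
Local Notation W2 := (walk_mx H).

Lemma walk_mx_col0 (K : sgraph n.+1) i : walk_mx K i 0 = 1.
Proof. by rewrite mxE expr0 mul1mx mxE. Qed.

Lemma walk_gram_mate : W1^T *m W1 = W2^T *m W2.
Proof. exact: esym (same_gen_spectrum_gram HG). Qed.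

Lemma walk_det_mate : \det W2 != 0.
Proof.
exact: (det_neq0_gram walk_gram_mate Gctrl).
Qed.

Lemma walk_mx_mulX_mate : B *m W2 = W2 *m mulX_mx n (char_poly A).
Proof.
by rewrite walk_mx_mulX; case: HG => /char_poly_eq_spectrum chHG _; rewrite chHG.
Qed.

Lemma theta_prime_level p l (U : 'M[int]_n.+1) (theta_odd : ~~ (2 %| theta G)%Z)
    (Phi_sqfree : forall p : nat, prime p -> (p%:Z ^+ 2 %| theta G)%Z ->
       coprimep (Phi p G) (Phi p G)^`()) :
  prime p -> (p%:Z %| l)%Z -> l != 0 -> U *m W2 = l *: W1 -> redmx p U = 0.
Proof.
move=> p_pr pl l0 UW; apply/eqP/negPn/negP => U0.
have Asym := trmx_adj_mx int G; have Bsym := trmx_adj_mx int H.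
have W20 := walk_det_mate; have gram := walk_gram_mate.
have AW := walk_mx_mulX G; have BW := walk_mx_mulX_mate.
have W1e := walk_mx_col0 G; have W2e := walk_mx_col0 H.
have UU := mate_gram W20 gram UW.
have UTW := mate_trmx W20 gram l0 UW.
have AU := mate_comm W20 AW BW UW.
have Ue := mate_ones W20 gram W1e W2e l0 UW.
have p2D : (p%:Z ^+ 2 %| discriminant G)%Z.
  rewrite dvdzE discriminantE -dvdzE.
  exact: (dvdz_sqr_det_deriv p_pr pl U0 UU Ue Asym Bsym AU).
have [p2|op] := even_prime p_pr.
  (* For [p = 2], one factor 2 in both arguments of the gcd is already a contradiction. *)
  case/negP: theta_odd; rewrite /theta dvdz_gcd; apply/andP; split; last first.
    by move: p2D; rewrite p2; apply: dvdz_trans.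
  rewrite p2 in U0 pl; have [i [j Uij]] := @redmx_neq0P 2 isT _ _ _ U0.
  apply: (dvdz2_det_walk Asym (adj_mx_diag int G) (u := col j U)).
  - by apply: contraNneq Uij => /eqP /(@redmx_eq0P 2 isT) /(_ i 0); rewrite mxE.
  - move=> k; set x := _ *m const_mx 1.
    have -> : (x^T *m col j U) 0 0 = (U^T *m x) j 0.
      rewrite mxE [RHS]mxE; apply: eq_bigr => s _.
      by rewrite mulrC [x^T _ _]mxE [col _ _ _ _]mxE [U^T _ _]mxE.
    rewrite (mate_walk W20 gram AW BW Asym Bsym W1e W2e l0 UW) mxE.
    exact: dvdz_mulr.
  move=> k; rewrite (mate_quadratic W20 gram AW BW Asym Bsym UW).
  by apply: dvdz_mulr; exact: (@dvdz_exp2r 2 l 2).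
have p2W : (p%:Z ^+ 2 %| \det W1)%Z.
  apply: (dvdz_sqr_det_intertwined p_pr pl U0 Asym Bsym gram AW BW AU UTW UW).
  (* Reduction modulo [p] keeps the companion form, whose eigenspaces are lines. *)
  by move=> mu a b; rewrite map_mulX_mx; apply: mulX_mx_eigenline.
have := Phi_not_squarefree p_pr pl U0 UU Ue Bsym AU.
case/negP; apply: Phi_sqfree; first exact: p_pr.
rewrite /theta dvdz_gcd p2D andbT.
exact: (dvdz_walk_det_odd_prime p_pr op p2W).
Qed.

Lemma isomorphic_of_theta (theta_odd : ~~ (2 %| theta G)%Z)
    (Phi_sqfree : forall p : nat, prime p -> (p%:Z ^+ 2 %| theta G)%Z ->
       coprimep (Phi p G) (Phi p G)^`()) :
  isomorphic H G.
Proof.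
have W20 := walk_det_mate; have gram := walk_gram_mate.
have [|U UW] := level_one W20 (W1 := W1).
  by move=> p l U; exact: (theta_prime_level theta_odd Phi_sqfree).
have {}UW : U *m W2 = 1 *: W1 by rewrite scale1r.
apply: (isomorphic_of_orthogonal (U := U)).
- by rewrite (mate_gram W20 gram UW) expr1n.
- exact: (mate_ones W20 gram (walk_mx_col0 G) (walk_mx_col0 H) (oner_neq0 _) UW).
exact: (mate_comm W20 (walk_mx_mulX G) walk_mx_mulX_mate UW).
Qed.

End Mates.

Theorem corollary1 (n : nat) (G : sgraph n)
    (Gctrl : controllable G)
    (theta_odd : ~~ (2 %| theta G)%Z)
    (Phi_sqfree : forall p : nat, prime p -> (p%:Z ^+ 2 %| theta G)%Z ->
       coprimep (Phi p G) (Phi p G)^`()) :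
  DGS G.
Proof.
move=> m H HG; have mn : m = n.
  by case: HG => /perm_size; rewrite !size_spectrum.
subst m; case: n G H Gctrl theta_odd Phi_sqfree HG => [|n] G H Gctrl theta_odd Phi_sqfree HG.
  by exists id; [exists id | case].
exact: (isomorphic_of_theta Gctrl HG theta_odd Phi_sqfree).
Qed.
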